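(* Let $n\ge1$ and $f(u)=|u|^{4/n}u\,e^{u^2}$. There is $\varepsilon>0$ such that the following holds. Let $\varphi\ge0$, $\varphi\in\exp L^2\cap L^1$ with $\|\varphi\|_{\exp L^2}<\varepsilon$, and let $u$ be the solution of the Cauchy problem $\partial_tu=\Delta u+f(u)$, $u(0)=\varphi$, satisfying $\sup_{t>0}\|u(t)\|_{\exp L^2}\le2\|\varphi\|_{\exp L^2}$. Suppose that a) for $n\ge1$, $\ \sup_{t>0}t^{\frac n2\left(1-\frac1q\right)}\|u(t)\|_{L^q}<\infty$ for all $q\in[1,\infty]$; b) for $n\ge5$, moreover, there is $T^*>0$ such that $\sup_{0<t<T^*}\|u(t)\|_{L^{\frac4n+1}}<\infty$. Then the limit $$m_*:=\lim_{t\to\infty}\int_{\mathbb{R}^n}u(t,x)\,dx=\int_{\mathbb{R}^n}\varphi(x)\,dx+\int_0^\infty\int_{\mathbb{R}^n}f(u(t,x))\,dx\,dt$$ exists, and $$\lim_{t\to\infty}t^{\frac n2\left(1-\frac1q\right)}\|u(t)-m_*g(t)\|_{L^q}=0,\qquad q\in[1,\infty],$$ where $g(t,x)=G_2(t+1,x)$ and $G_2(t,x)=(4\pi t)^{-\frac n2}e^{-\frac{|x|^2}{4t}}$.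
   Context: Orlicz space: $\exp L^2=\exp L^2(\mathbb{R}^n)$ is the space of $u\in L^1_{loc}(\mathbb{R}^n)$ such that $\int_{\mathbb{R}^n}(\exp((|u(x)|/\lambda)^2)-1)\,dx<\infty$ for some $\lambda>0$, with the Luxemburg norm $\|u\|_{\exp L^2}=\inf\{\lambda>0:\int_{\mathbb{R}^n}(\exp((|u(x)|/\lambda)^2)-1)\,dx\le1\}$. Weak$^*$ convergence: the predual of $\exp L^2$ is the Orlicz space of the complementary function $\tilde A(t)=\sup_{s\ge0}(ts-A(s))$ of $A(s)=e^{s^2}-1$. ''$u(t)\to\varphi$ in the weak$^*$ topology as $t\to0$'' means $\lim_{t\to0}\int_{\mathbb{R}^n}(u(t,x)-\varphi(x))\psi(x)\,dx=0$ for every $\psi$ in this predual. Heat semigroup: $e^{t\Delta}\varphi=G_2(t,\cdot)*\varphi$. Solution: ''solution'' means mild solution in $(0,\infty)\times\mathbb{R}^n$: $u\in L^\infty(0,\infty;\exp L^2)\cap C((0,\infty);\exp L^2)$, $u(t)=e^{t\Delta}\varphi+\int_0^te^{(t-s)\Delta}f(u(s))\,ds$ for $t>0$, and $u(t)\to\varphi$ in the weak$^*$ topology as $t\to0$. $L^q=L^q(\mathbb{R}^n)$. *)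

(* Defs.v *)
From HB Require Import structures.
From mathcomp Require Import all_boot all_order all_algebra.
From mathcomp Require Import all_classical all_reals all_analysis.

Set Implicit Arguments.
Unset Strict Implicit.
Unset Printing Implicit Defensive.

Import Order.TTheory GRing.Theory Num.Theory.
Import numFieldNormedType.Exports.

Local Open Scope classical_set_scope.
Local Open Scope ring_scope.

(* The library's sigma-finite instance for \x is shadowed by the one for
   subprobabilities, so it cannot be found by unification. *)
Lemma sigma_finite_product_measure1 {d1 d2 : measure_display}
    {T1 : measurableType d1} {T2 : measurableType d2} {R : realType}
    (m1 : {sigma_finite_measure set T1 -> \bar R})
    (m2 : {sigma_finite_measure set T2 -> \bar R}) :
  sigma_finite setT (m1 \x m2)%E.
Proof.
have /sigma_finiteP[F [TF ndF Foo]] := sigma_finiteT m1.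
have /sigma_finiteP[G [TG ndG Goo]] := sigma_finiteT m2.
exists (fun n => F n `*` G n).
  rewrite -setXTT TF TG predeqE => -[x y]; split.
    move=> [/= [n _ Fnx] [k _ Gky]]; exists (maxn n k) => //; split.
    - by move: x Fnx; exact/subsetPset/ndF/leq_maxl.
    - by move: y Gky; exact/subsetPset/ndG/leq_maxr.
  by move=> [n _ []/= ? ?]; split; exists n.
move=> k; have [? ?] := Foo k; have [? ?] := Goo k.
split; first exact: measurableX.
by rewrite product_measure1E// lte_mul_pinfty// ge0_fin_numE.
Qed.

(* The n-fold product of m on n-tuples, by recursion on n: the image of
   m \x (m ^ n) under (a, v) |-> a :: v. *)
Section power_measure.
Context {d : measure_display} {T : measurableType d} {R : realType}.

Definition tcons n (p : T * n.-tuple T) : n.+1.-tuple T :=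
  [tuple of p.1 :: p.2].

Definition tuncons n (v : n.+1.-tuple T) : T * n.-tuple T :=
  (thead v, [tuple of behead v]).

Lemma measurable_tcons n : measurable_fun setT (@tcons n).
Proof. exact: measurable_cons. Qed.

Lemma measurable_tuncons n : measurable_fun setT (@tuncons n).
Proof.
by apply/measurable_fun_pairP; split;
  [exact: measurable_tnth|exact: measurable_behead].
Qed.

Lemma tconsK n : cancel (@tcons n) (@tuncons n).
Proof. by case=> a v; congr pair; apply: val_inj. Qed.

Section step.
Variables (n : nat) (m1 : {sigma_finite_measure set T -> \bar R})
  (m2 : {sigma_finite_measure set (n.-tuple T) -> \bar R}).

Definition cons_measure := pushforward (m1 \x m2)%E (@tcons n).

Let cons_measure0 : cons_measure set0 = 0%E.
Proof. by rewrite /cons_measure /pushforward preimage_set0 measure0. Qed.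

Let cons_measure_ge0 A : (0 <= cons_measure A)%E.
Proof. exact: (@measure_ge0 _ _ _ (m1 \x m2)%E). Qed.

Let cons_measure_sigma_additive : semi_sigma_additive cons_measure.
Proof.
have mf := @measurable_tcons n.
pose m := measure_function_pushforward__canonical__measure_function_Measure
  (m1 \x m2)%E mf.
exact: (@measure_semi_sigma_additive _ _ _ m).
Qed.

HB.instance Definition _ := isMeasure.Build _ _ _ cons_measure
  cons_measure0 cons_measure_ge0 cons_measure_sigma_additive.

Let cons_measure_sigma_finite : sigma_finite setT cons_measure.
Proof.
have [F FT Foo] := sigma_finite_product_measure1 m1 m2.
exists (fun k => @tuncons n @^-1` F k).
  by rewrite -preimage_bigcup -FT preimage_setT.
move=> k; have [mF Fk] := Foo k; split.
  by rewrite -[X in measurable X]setTI; exact: measurable_tuncons.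
rewrite /cons_measure /pushforward -comp_preimage.
by rewrite (_ : tuncons (n:=n) \o tcons (n:=n) = id)//; apply/funext/tconsK.
Qed.

HB.instance Definition _ := Measure_isSigmaFinite.Build _ _ _ cons_measure
  cons_measure_sigma_finite.
End step.

Fixpoint power_measure (m : {sigma_finite_measure set T -> \bar R}) (n : nat) :
    {sigma_finite_measure set (n.-tuple T) -> \bar R} :=
  match n with
  | 0 => \d_[tuple]
  | n'.+1 => cons_measure m (power_measure m n')
  end.

End power_measure.

Lemma power_measure_rectangle {d : measure_display} {T : measurableType d}
    {R : realType} (m : {sigma_finite_measure set T -> \bar R}) (n : nat)
    (A : 'I_n -> set T) : (forall i, measurable (A i)) ->
  power_measure m n [set x | forall i, A i (tnth x i)] =
  (\prod_(i < n) m (A i))%E.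
Proof.
elim: n A => [|n IH] A mA.
  rewrite big_ord0 /= diracE mem_set//= => -[].
  by [].
rewrite big_ord_recl -IH//= /cons_measure /pushforward.
have mB : measurable [set x : n.-tuple T | forall i, A (lift ord0 i) (tnth x i)].
  rewrite (_ : mkset _ = \bigcap_(i in [set: 'I_n])
    ((@tnth n T ^~ i) @^-1` A (lift ord0 i))).
    apply: fin_bigcap_measurable => [|i _]; first exact: finite_finset.
    by rewrite -[X in measurable X]setTI; exact: measurable_tnth.
  by apply/seteqP; split => [x xA i _|x xA i]; exact: xA.
rewrite -product_measure1E//; congr (product_measure1 _ _ _).
apply/seteqP; split => -[a x] /=.
  move=> xA; split=> [|i]; first by have := xA ord0; rewrite tnth0.
  by have := xA (lift ord0 i); rewrite tnthS.
case=> Aa xA i; case: (unliftP ord0 i) => [j ->|->]; last by rewrite tnth0.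
by rewrite tnthS.
Qed.

Section heat.
Context {R : realType}.
Implicit Types (n : nat) (t l : R) (q : \bar R).

(* Functions on R^n are Borel representatives of classes modulo null sets. *)
Local Notation Rn n := (n.-tuple (measurableTypeR R)).

Definition lebesgue_Rn n : {sigma_finite_measure set (Rn n) -> \bar R} :=
  power_measure (@lebesgue_measure R) n.

Definition sqnorm n (x : Rn n) : R := \sum_(i < n) (tnth x i : R) ^+ 2.

Definition tsub n (x y : Rn n) : Rn n :=
  [tuple (tnth x i : R) - (tnth y i : R) | i < n].

Definition L1loc n (u : Rn n -> R) : Prop :=
  measurable_fun setT u /\
  forall r : R, (lebesgue_Rn n).-integrable [set x | sqnorm x <= r ^+ 2]
    (EFin \o u).

(* Young functions take values in \bar R and are only evaluated on [0, +oo[. *)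
Definition orlicz n (A : R -> \bar R) (u : Rn n -> R) : Prop :=
  L1loc u /\
  exists l : R, 0 < l /\ (\int[lebesgue_Rn n]_x A (`|u x| / l)%R < +oo)%E.

Definition luxemburg_norm n (A : R -> \bar R) (u : Rn n -> R) : \bar R :=
  ereal_inf [set l%:E | l in
    [set l : R | 0 < l /\ (\int[lebesgue_Rn n]_x A (`|u x| / l)%R <= 1)%E]].

Definition complementary (A : R -> \bar R) (t : R) : \bar R :=
  ereal_sup [set ((t * s)%:E - A s)%E | s in [set s : R | 0 <= s]].

Definition young_exp2 (s : R) : \bar R := (expR (s ^+ 2) - 1)%:E.

Definition expL2 n (u : Rn n -> R) : Prop := orlicz young_exp2 u.

Definition expL2_norm n (u : Rn n -> R) : \bar R := luxemburg_norm young_exp2 u.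

Definition expL2_predual n (psi : Rn n -> R) : Prop :=
  orlicz (complementary young_exp2) psi.

Definition heat_kernel n (t : R) (x : Rn n) : R :=
  (4 * pi * t) `^ (- (n%:R / 2)) * expR (- (sqnorm x / (4 * t))).

Definition heat_semigroup n (t : R) (v : Rn n -> R) (x : Rn n) : \bar R :=
  (\int[lebesgue_Rn n]_y (heat_kernel t (tsub x y) * v y)%:E)%E.

Definition source n (v : R) : R :=
  `|v| `^ (4 / n%:R) * v * expR (v ^+ 2).

(* u t is a function on R^n for every t, defined up to a null set; only its
   values at t > 0 matter.  The Duhamel formula is an equality of extended reals
   whose left-hand side is finite.  As oo - oo = -oo in \bar R, it forces the
   integrals of the positive and negative parts to be finite. *)
Record mild_solution n (phi : Rn n -> R) (u : R -> Rn n -> R) : Prop := {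
  mild_expL2 : forall t, 0 < t -> expL2 (u t) ;
  mild_bounded : exists M : R,
    {ae @lebesgue_measure R, forall t, 0 < t -> (expL2_norm (u t) <= M%:E)%E} ;
  mild_continuous : forall t0, 0 < t0 ->
    expL2_norm (u t \- u t0) @[t --> t0] --> 0%E ;
  mild_duhamel : forall t, 0 < t ->
    {ae lebesgue_Rn n, forall x, (u t x)%:E = heat_semigroup t phi x +
      \int[@lebesgue_measure R]_(s in `]0%R, t[)
        heat_semigroup (t - s)%R (source n \o u s) x}%E ;
  mild_initial : forall psi : Rn n -> R, expL2_predual psi ->
    (\int[lebesgue_Rn n]_x ((u t x - phi x) * psi x)%:E)%E @[t --> 0^'+]
      --> 0%E }.

(* (n / 2) (1 - 1 / q), with 1 / +oo = 0 *)
Definition decay_exponent n (q : \bar R) : R := n%:R / 2 * (1 - fine q^-1%E).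

End heat.

(* Main.v *)
(* By Duhamel's formula, u(t) - m_* g(t) is the sum of the deviation of
   e^{t Delta} phi from its mass times g(t) and of the integral over s > 0 of a
   remainder H_t(s), which is the deviation of e^{(t-s) Delta} f(u(s)) from its
   mass times g(t) for s < t, and minus this mass times g(t) for s >= t.
   Comparing G(t - s, x - y) with G(t + 1, x) both in L^1 and in L^oo produces
   one function e_t(s) that bounds the L^1 norm of H_t(s) and t^{n/2} times its
   sup norm.  Since the L^1 norm of f(u(s)) is O(1/(1 + s^2)) -- for small s by
   the exp L^2 bound, and for n >= 5 by hypothesis b) -- dominated convergence
   makes the integral of e_t tend to 0.  This is the claim for q = 1 and q = oo,
   and interpolation gives the other exponents. *)

Require Import Defs.
From HB Require Import structures.
From mathcomp Require Import all_boot all_order all_algebra.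
From mathcomp Require Import all_classical all_reals all_analysis.
From mathcomp Require Import ring lra measurable_realfun ess_sup_inf.

Import Order.TTheory GRing.Theory Num.Theory.
Import numFieldNormedType.Exports.

Local Open Scope classical_set_scope.
Local Open Scope ring_scope.

Set Implicit Arguments.
Unset Strict Implicit.
Unset Printing Implicit Defensive.

(** * Pointwise comparison of a shifted and a centred heat kernel *)

Section heat_kernel_pointwise.
Context {R : realType}.
Local Notation Rn n := (n.-tuple (measurableTypeR R)).
Implicit Types (n : nat) (tau sig del : R).

(** No derivative of the heat kernel is taken: by Young's inequality with a parameter [del], G(t -
    s, x - y) and G(t + 1, x) both lie above one multiple, of mass close to 1, of a third Gaussian.
    With [del] equal to t^(-1/2) the resulting defect is O(t^(-1/2)) for fixed s and y, and
    truncated at 2 it requires no moments of the data. The exponent 4/n turns the decay t^(-n/2) of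
    the sup norm into |u|^(4/n) = O(t^(-2)), integrable at infinity. For small times |f(u)| is
    compared with e^(4 u^2) - 1, whose integral is at most 1 once the exp L^2 norm of u(t) is below
    1/2. This function is quadratic at u = 0, so for n >= 5 it does not dominate |u|^(1 + 4/n), and
    b) enters. A further obstacle is measurability: the solution is a family of representatives, one
    for each time, with no joint measurability in time and space, while Tonelli's theorem requires
    it of the remainder. It is recovered from measurability in x and continuity in s, the latter
    because s |-> f(u(s)) is continuous in L^1. *)

Lemma sqnorm_ge0 n (x : Rn n) : 0 <= sqnorm x.
Proof. by apply: sumr_ge0 => i _; exact: sqr_ge0. Qed.

Lemma sqr_subr_young (a b d : R) : 0 < d ->
  (a - b) ^+ 2 <= (1 + d) * a ^+ 2 + (1 + d^-1) * b ^+ 2.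
Proof.
move=> d0; rewrite -subr_ge0 (_ : _ - _ = (d * a + b) ^+ 2 / d); last first.
  by field; rewrite gt_eqF.
by rewrite divr_ge0 ?sqr_ge0 ?ltW.
Qed.

Lemma sqr_le_subr_young (a b d : R) : 0 < d ->
  a ^+ 2 <= (1 + d) * (a - b) ^+ 2 + (1 + d^-1) * b ^+ 2.
Proof.
move=> d0; rewrite -subr_ge0.
rewrite (_ : _ - _ = (d * (a - b) - b) ^+ 2 / d); last first.
  by field; rewrite gt_eqF.
by rewrite divr_ge0 ?sqr_ge0 ?ltW.
Qed.

Lemma sqnorm_tsub_le n (x y : Rn n) (d : R) : 0 < d ->
  sqnorm (tsub x y) <= (1 + d) * sqnorm x + (1 + d^-1) * sqnorm y.
Proof.
move=> d0; rewrite /sqnorm !mulr_sumr -big_split/=; apply: ler_sum => i _.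
by rewrite tnth_mktuple; exact: sqr_subr_young.
Qed.

Lemma sqnorm_le_tsub n (x y : Rn n) (d : R) : 0 < d ->
  sqnorm x <= (1 + d) * sqnorm (tsub x y) + (1 + d^-1) * sqnorm y.
Proof.
move=> d0; rewrite /sqnorm !mulr_sumr -big_split/=; apply: ler_sum => i _.
by rewrite tnth_mktuple; exact: sqr_le_subr_young.
Qed.

(** The term in y that Young's inequality with parameter [del] leaves when |x - y|^2 / (4 tau) is
    replaced by (1 + del) |x|^2 / (4 tau). *)
Definition shift_cost n tau del (y : Rn n) : R :=
  (1 + del^-1) * sqnorm y / (4 * tau).

(** Ratio of [sig] to [tau / (1 + del)], the time at which a centred Gaussian has the exponent (1 +
    del) |x|^2 / (4 tau). *)
Definition dilation tau sig del : R := (1 + del) * sig / tau.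

(** One quantity for two estimates: with r the shift cost and k the dilation, the L^1 distance of
    the kernels is at most 2 r + n (k - 1), and the sup distance, up to normalisation, at most r +
    (n + 1) (k - 1). *)
Definition kernel_defect n tau sig del (y : Rn n) : R :=
  2 * shift_cost tau del y + n.+1%:R * (dilation tau sig del - 1).

Lemma shift_cost_ge0 n tau del (y : Rn n) : 0 < tau -> 0 < del ->
  0 <= shift_cost tau del y.
Proof.
move=> tau0 del0; rewrite /shift_cost !mulr_ge0 ?sqnorm_ge0 ?invr_ge0//.
  by rewrite addr_ge0 ?invr_ge0 ?ltW.
by rewrite mulr_ge0 ?ltW.
Qed.

Lemma dilation_ge1 tau sig del : 0 < tau -> tau <= sig -> 0 < del ->
  1 + del <= dilation tau sig del.
Proof.
move=> tau0 tausig del0; rewrite /dilation -mulrA ler_peMr ?addr_ge0 ?(ltW del0)//.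
by rewrite ler_pdivlMr// mul1r.
Qed.

Lemma heat_kernel_ge0 n tau (x : Rn n) : 0 <= heat_kernel tau x.
Proof. by rewrite mulr_ge0 ?powR_ge0 ?expR_ge0. Qed.

Lemma powRN_ge1B (k a : R) : 0 < k -> 0 <= a -> 1 - a * (k - 1) <= k `^ (- a).
Proof.
move=> k0 a0; rewrite /powR gt_eqF//.
apply: le_trans (expR_ge1Dx _); rewrite lerD2l mulNr lerN2 ler_wpM2l//.
by have := @le_ln1Dx _ (k - 1); rewrite [1 + _]addrC subrK; apply; rewrite ltrBrDr addNr.
Qed.

(* Both G(tau, x - y) and G(sig, x) dominate the common part
   common_mass * G(tau / (1 + del), x); outside it they have mass
   1 - common_mass each. *)
Definition common_mass n tau sig del (y : Rn n) : R :=
  expR (- shift_cost tau del y) * dilation tau sig del `^ (- (n%:R / 2)).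

(** Written as one exponential, the common mass is exp(- r - (n/2) ln k), and ln k <= k - 1, e^z >=
    1 + z. *)
Lemma common_mass_ge n tau sig del (y : Rn n) :
  0 < tau -> tau <= sig -> 0 < del ->
  2 * (1 - common_mass tau sig del y) <= kernel_defect tau sig del y.
Proof.
move=> tau0 tausig del0.
have r0 := shift_cost_ge0 y tau0 del0.
have k1 := dilation_ge1 tau0 tausig del0.
rewrite /common_mass /kernel_defect; set r := shift_cost _ _ _ in r0 *.
set k := dilation _ _ _ in k1 *.
have k0 : 0 < k by lra.
have n0 : 0 <= n%:R / 2 :> R by rewrite divr_ge0.
have h : 1 - r - n%:R / 2 * (k - 1) <= expR (- r) * k `^ (- (n%:R / 2)).
  rewrite /powR gt_eqF// -expRD.
  apply: le_trans (expR_ge1Dx _); rewrite -addrA lerD2l lerD2l mulNr lerN2.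
  rewrite ler_wpM2l//.
  by have := @le_ln1Dx _ (k - 1); rewrite [1 + _]addrC subrK; apply; lra.
have -> : n.+1%:R = n%:R + 1 :> R by rewrite -natr1.
have : 0 <= k - 1 by lra.
move: h; set e := _ * _ `^ _ => h k10; nra.
Qed.

(** In this form the normalisation is that of G(sig), which is at most that of G(tau); what remains
    is to compare exponents. *)
Lemma common_massE n tau sig del (x y : Rn n) :
  0 < tau -> tau <= sig -> 0 < del ->
  common_mass tau sig del y * heat_kernel (tau / (1 + del)) x =
  (4 * pi * sig) `^ (- (n%:R / 2)) *
    expR (- ((1 + del) * (sqnorm x / (4 * tau)) + shift_cost tau del y)).
Proof.
move=> tau0 tausig del0; rewrite /common_mass /heat_kernel.
have sig0 : 0 < sig by exact: lt_le_trans tausig.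
have d1 : 0 < 1 + del by rewrite addr_gt0.
rewrite [expR (- shift_cost _ _ _) * _]mulrC mulrACA -powRM; last 2 first.
- by have := dilation_ge1 tau0 tausig del0; lra.
- by rewrite !mulr_ge0 ?pi_ge0 ?invr_ge0// ltW.
rewrite -expRD; congr (_ `^ _ * expR _).
  by rewrite /dilation; field; rewrite !gt_eqF.
by field; rewrite !gt_eqF.
Qed.

Lemma common_mass_le_shifted n tau sig del (x y : Rn n) :
  0 < tau -> tau <= sig -> 0 < del ->
  common_mass tau sig del y * heat_kernel (tau / (1 + del)) x <=
  heat_kernel tau (tsub x y).
Proof.
move=> tau0 tausig del0; rewrite common_massE// /heat_kernel.
have sig0 : 0 < sig by exact: lt_le_trans tausig.
have pt0 : 0 < 4 * pi * tau by rewrite !mulr_gt0 ?pi_gt0.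
have ps0 : 0 < 4 * pi * sig by rewrite !mulr_gt0 ?pi_gt0.
have pts : 4 * pi * tau <= 4 * pi * sig by rewrite ler_pM2l// mulr_gt0 ?pi_gt0.
have hp : (4 * pi * sig) `^ (- (n%:R / 2)) <= (4 * pi * tau) `^ (- (n%:R / 2)).
  rewrite !powRN lef_pV2 ?posrE ?powR_gt0//.
  by apply: ge0_ler_powR => //; rewrite ?nnegrE ?divr_ge0// ltW.
apply: ler_pM => //; rewrite ?powR_ge0 ?expR_ge0//.
rewrite ler_expR lerN2 /shift_cost mulrA -mulrDl.
by rewrite ler_wpM2r ?sqnorm_tsub_le// invr_ge0 mulr_ge0 ?(ltW tau0).
Qed.

Lemma common_mass_le_dilated n tau sig del (x y : Rn n) :
  0 < tau -> tau <= sig -> 0 < del ->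
  common_mass tau sig del y * heat_kernel (tau / (1 + del)) x <=
  heat_kernel sig x.
Proof.
move=> tau0 tausig del0; rewrite common_massE// /heat_kernel.
have sig0 : 0 < sig by exact: lt_le_trans tausig.
rewrite ler_wpM2l ?powR_ge0// ler_expR lerN2.
rewrite (@le_trans _ _ ((1 + del) * (sqnorm x / (4 * tau))))//; last first.
  by rewrite lerDl shift_cost_ge0.
have z0 : 0 <= sqnorm x / (4 * tau) by rewrite divr_ge0 ?sqnorm_ge0 ?mulr_ge0 ?ltW.
rewrite (@le_trans _ _ (sqnorm x / (4 * tau)))//; last first.
  by rewrite ler_peMl// lerDl ltW.
by rewrite ler_wpM2l ?sqnorm_ge0// lef_pV2 ?posrE ?mulr_gt0// ler_pM2l.
Qed.

(** For a, b >= c one has |a - b| = a + b - 2 min(a, b) <= a + b - 2 c. *)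
Lemma heat_kernel_dist_le n tau sig del (x y : Rn n) :
  0 < tau -> tau <= sig -> 0 < del ->
  `|heat_kernel tau (tsub x y) - heat_kernel sig x| +
    2 * (common_mass tau sig del y * heat_kernel (tau / (1 + del)) x) <=
  heat_kernel tau (tsub x y) + heat_kernel sig x.
Proof.
move=> tau0 tausig del0.
have := common_mass_le_shifted x y tau0 tausig del0.
have := common_mass_le_dilated x y tau0 tausig del0.
set c := common_mass _ _ _ _ * _ => h1 h2.
by have [h|h] := ger0P (heat_kernel tau (tsub x y) - heat_kernel sig x); lra.
Qed.

Lemma heat_kernel_sup n tau (x : Rn n) : 0 < tau ->
  heat_kernel tau x <= (4 * pi * tau) `^ (- (n%:R / 2)).
Proof.
move=> tau0; rewrite /heat_kernel ler_piMr ?powR_ge0// -[leRHS]expR0 ler_expR.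
by rewrite oppr_le0 divr_ge0 ?sqnorm_ge0// mulr_ge0// ltW.
Qed.

(** Absorbs the exponents that appear as factors when the comparison of two exponentials is
    linearised. *)
Lemma mulr_expRN_le (z : R) : z * expR (- z) <= 1.
Proof.
rewrite expRN ler_pdivrMr ?expR_gt0// mul1r.
by rewrite (le_trans _ (expR_ge1Dx _))// lerDr.
Qed.

(** Without the common factor, e^(- z') is compared with th e^(- w), where z' and w are the two
    exponents. Young's inequality in both directions bounds each exponent by the other up to a
    factor close to 1 and the shift cost; since z e^(- z) <= 1, that factor costs at most its
    distance to 1. The ratio th of the normalisations lies within (n/2) (sig / tau - 1) of 1. *)
Lemma heat_kernel_dist_sup n tau sig del (x y : Rn n) :
  0 < tau -> tau <= sig -> 0 < del ->
  `|heat_kernel tau (tsub x y) - heat_kernel sig x| <=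
  (4 * pi * tau) `^ (- (n%:R / 2)) * Num.min 1 (kernel_defect tau sig del y).
Proof.
move=> tau0 tausig del0.
have sig0 : 0 < sig by exact: lt_le_trans tausig.
have ts1 : 1 <= sig / tau by rewrite ler_pdivlMr// mul1r.
pose th := (sig / tau) `^ (- (n%:R / 2)).
have n0 : 0 <= n%:R / 2 :> R by rewrite divr_ge0.
have th1 : th <= 1.
  by rewrite /th powRN invf_le1 ?powR_gt0 ?(lt_le_trans ltr01)// -[leLHS](powRr0 (sig/tau)) ler_powR.
have th0 : 0 <= th by exact: powR_ge0.
rewrite /heat_kernel.
rewrite (_ : (4 * pi * sig) `^ (- (n%:R / 2)) =
    (4 * pi * tau) `^ (- (n%:R / 2)) * th); last first.
  rewrite /th -powRM.
  - by congr (_ `^ _); field; rewrite gt_eqF.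
  - by rewrite !mulr_ge0 ?pi_ge0 ?(ltW tau0).
  - exact: le_trans ts1.
rewrite -[X in _ - X]mulrA -mulrBr normrM ger0_norm ?powR_ge0// ler_wpM2l ?powR_ge0//.
have r0 := shift_cost_ge0 y tau0 del0.
have k1 := dilation_ge1 tau0 tausig del0.
pose z' := sqnorm (tsub x y) / (4 * tau); pose z := sqnorm x / (4 * tau).
have c0 : 0 < (4 * tau)^-1 by rewrite invr_gt0 mulr_gt0.
have z'0 : 0 <= z' by rewrite mulr_ge0 ?sqnorm_ge0 ?ltW.
have z0 : 0 <= z by rewrite mulr_ge0 ?sqnorm_ge0 ?ltW.
have zz' : z <= (1 + del) * z' + shift_cost tau del y.
  rewrite /z /z' /shift_cost mulrA -mulrDl ler_wpM2r ?(ltW c0)//.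
  exact: sqnorm_le_tsub.
have z'z : z' <= (1 + del) * z + shift_cost tau del y.
  rewrite /z /z' /shift_cost mulrA -mulrDl ler_wpM2r ?(ltW c0)//.
  exact: sqnorm_tsub_le.
have := powRN_ge1B (lt_le_trans ltr01 ts1) n0; rewrite -/th => thB.
pose w := sqnorm x / (4 * sig).
have zE : z = w * (sig / tau) by rewrite /z /w; field; rewrite !gt_eqF.
have w0 : 0 <= w by rewrite mulr_ge0 ?sqnorm_ge0 ?invr_ge0 ?mulr_ge0 ?ltW.
have wz : w <= z by rewrite zE ler_peMr.
rewrite -/z' -/w /kernel_defect.
have kE : dilation tau sig del = (1 + del) * (sig / tau) by rewrite /dilation mulrA.
move: r0 k1 zz' z'z.
rewrite kE -[n.+1%:R]natr1; set r := shift_cost _ _ _; set s := sig / tau in ts1 thB zE *.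
move=> r0 k1 zz' z'z.
have nn0 : 0 <= n%:R :> R by [].
have ks : s - 1 <= (1 + del) * s - 1.
  by rewrite lerD2r -[leLHS]mul1r ler_wpM2r ?lerDl ?(ltW del0) ?(le_trans ler01).
have kd : del <= (1 + del) * s - 1 by lra.
have e'0 := expR_gt0 (- z'); have ew0 := expR_gt0 (- w).
have e'1 : expR (- z') <= 1 by rewrite -[leRHS]expR0 ler_expR oppr_le0.
have ew1 : expR (- w) <= 1 by rewrite -[leRHS]expR0 ler_expR oppr_le0.
have := mulr_expRN_le z'; have := mulr_expRN_le w => hw hz'.
have lo1 : expR (- z') * (1 - del * z' - r) <= expR (- w).
  rewrite (@le_trans _ _ (expR (- z') * expR (- (del * z') - r)))//.
    rewrite ler_pM2l// (le_trans _ (expR_ge1Dx _))//.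
    by rewrite -addrA.
  by rewrite -expRD ler_expR; lra.
have lo2 : expR (- w) * (1 - ((1 + del) * s - 1) * w - r) <= expR (- z').
  rewrite (@le_trans _ _ (expR (- w) * expR (- (((1 + del) * s - 1) * w) - r)))//.
    rewrite ler_pM2l// (le_trans _ (expR_ge1Dx _))//.
    by rewrite -addrA.
  by rewrite -expRD ler_expR; move: z'z; rewrite zE; lra.
have thw : th * expR (- w) <= expR (- w) by rewrite ler_piMl ?(ltW ew0).
have thw' : expR (- w) - th * expR (- w) <= n%:R / 2 * (s - 1).
  have h : 1 - th <= n%:R / 2 * (s - 1) by lra.
  rewrite -[X in X - _]mul1r -mulrBl; apply: le_trans h.
  by rewrite ler_piMr// subr_ge0.
have nks : n%:R / 2 * (s - 1) <= n%:R * ((1 + del) * s - 1).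
  apply: ler_pM => //; first lra.
  by rewrite ler_pdivrMr// ler_peMr// ler1n.
set K := (1 + del) * s - 1 in ks kd nks lo2 *.
have K0 : 0 <= K by lra.
have hr' : expR (- z') * r <= r by rewrite ler_piMl.
have hrw : expR (- w) * r <= r by rewrite ler_piMl.
have hd : expR (- z') * (del * z') <= del.
  by rewrite mulrCA -[leRHS]mulr1 ler_wpM2l ?(ltW del0)// mulrC.
have hK : expR (- w) * (K * w) <= K.
  by rewrite mulrCA -[leRHS]mulr1 ler_wpM2l// mulrC.
have thw0 : 0 <= th * expR (- w) by rewrite mulr_ge0 ?(ltW ew0).
have nK0 : 0 <= n%:R * K by rewrite mulr_ge0.
rewrite !mulrBr !mulr1 in lo1 lo2.
by rewrite le_min; apply/andP; split; rewrite ler_norml; apply/andP; split; lra.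
Qed.

End heat_kernel_pointwise.

(** * Mass of the heat kernel and L^1 distance of two kernels *)

Section heat_kernel_mass.
Context {R : realType}.
Local Notation Rn n := (n.-tuple (measurableTypeR R)).
Implicit Types (n : nat) (t tau sig del : R).

Lemma measurable_sqnorm n : measurable_fun setT (@sqnorm R n).
Proof.
apply: measurable_sum => i; apply: measurable_funX.
exact: (@measurable_tnth _ (measurableTypeR R)).
Qed.

Lemma measurable_heat_kernel n t : measurable_fun setT (@heat_kernel R n t).
Proof.
apply: measurable_funM => //; apply: measurableT_comp => //.
apply: measurableT_comp => //; apply: measurable_funM => //.
exact: measurable_sqnorm.
Qed.

Lemma measurable_tsub n :
  measurable_fun setT (fun p : Rn n * Rn n => tsub p.1 p.2).
Proof.
apply/(@measurable_fun_tnthP _ _ _ (measurableTypeR R)) => i.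
rewrite (_ : _ \o _ = (fun p : Rn n * Rn n =>
  (tnth p.1 i : R) - (tnth p.2 i : R))); last first.
  by apply/funext => p /=; rewrite tnth_mktuple.
apply: measurable_funB.
- exact: (measurableT_comp (@measurable_tnth _ (measurableTypeR R) n i) measurable_fst).
- exact: (measurableT_comp (@measurable_tnth _ (measurableTypeR R) n i) measurable_snd).
Qed.

Lemma measurable_heat_kernel_tsub n t :
  measurable_fun setT (fun p : Rn n * Rn n => heat_kernel t (tsub p.1 p.2)).
Proof. exact: measurableT_comp (@measurable_heat_kernel n t) (@measurable_tsub n). Qed.

Lemma measurable_tsubl n (y : Rn n) : measurable_fun setT (fun x => tsub x y).
Proof. exact: measurableT_comp (@measurable_tsub n) (measurable_pair2 y). Qed.

Lemma measurable_tsubr n (x : Rn n) : measurable_fun setT (fun y => tsub x y).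
Proof. exact: measurableT_comp (@measurable_tsub n) (measurable_pair1 x). Qed.

(** [lebesgue_Rn n.+1] is by construction the image of a product measure under [tcons], so Tonelli's
    theorem splits off the first coordinate. *)
Lemma ge0_integral_lebesgue_RnS n (f : Rn n.+1 -> \bar R) :
  measurable_fun setT f -> (forall x, 0 <= f x)%E ->
  (\int[lebesgue_Rn n.+1]_x f x =
   \int[@lebesgue_measure R]_a \int[lebesgue_Rn n]_v f (tcons (a, v)))%E.
Proof.
move=> mf f0.
rewrite [LHS](@ge0_integral_pushforward _ _ _ _ R _ (@measurable_tcons _ _ n)
  (@lebesgue_measure R \x lebesgue_Rn n)%E)//.
have mft := measurableT_comp mf (@measurable_tcons _ (measurableTypeR R) n).
by rewrite preimage_setT (fubini_tonelli1 _ mft)// => x; exact: f0.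
Qed.

(** In one coordinate the heat kernel at time t is the normal density of variance 2 t; its mass thus
    follows from that of the normal law by induction on the dimension. *)
Lemma heat_kernel_tcons n t (a : R) (v : Rn n) (y : Rn n.+1) : 0 < t ->
  heat_kernel t (tsub (tcons (a, v)) y) =
  normal_pdf (thead y : R) (Num.sqrt (2 * t)) a *
  heat_kernel t (tsub v [tuple of behead y]).
Proof.
move=> t0; have s0 : Num.sqrt (2 * t) != 0 :> R.
  by rewrite sqrtr_eq0 -ltNge mulr_gt0.
rewrite normal_pdfE// /normal_peak /normal_fun.
rewrite sqr_sqrtr ?mulr_ge0 ?ltW// /heat_kernel.
have -> : 2 * t * pi *+ 2 = 4 * pi * t by rewrite -mulr_natr; ring.
have -> : sqnorm (tsub (tcons (a, v)) y) =
    (a - thead y) ^+ 2 + sqnorm (tsub v [tuple of behead y]).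
  rewrite /sqnorm big_ord_recl tnth_mktuple tnth0; congr (_ + _).
  apply: eq_bigr => i _; rewrite !tnth_mktuple tnthS.
  congr ((_ - _) ^+ 2).
  by rewrite (tnth_nth (0 : R)) [in RHS](tnth_nth (0 : R))/= nth_behead.
have p0 : 0 < 4 * pi * t by rewrite !mulr_gt0 ?pi_gt0.
rewrite -powR12_sqrt ?ltW// -powRN mulrACA -expRD -powRD; last first.
  by rewrite (gt_eqF p0) ?implybT.
congr (_ `^ _ * expR _); first by rewrite -natr1; field.
by field; rewrite gt_eqF.
Qed.

Lemma integral_heat_kernel_tsub n t (y : Rn n) : 0 < t ->
  (\int[lebesgue_Rn n]_x (heat_kernel t (tsub x y))%:E = 1)%E.
Proof.
move=> t0; elim: n y => [|n IH] y.
  rewrite [LHS]integral_dirac//; last first.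
    by apply/measurable_EFinP; exact: measurableT_comp (@measurable_heat_kernel 0 t) (measurable_tsubl y).
  rewrite diracE in_setT mul1e /heat_kernel /sqnorm !big_ord0.
  by rewrite !mul0r !oppr0 powRr0 expR0 mul1r.
rewrite ge0_integral_lebesgue_RnS; last 2 first.
- apply/measurable_EFinP.
  exact: measurableT_comp (@measurable_heat_kernel n.+1 t) (measurable_tsubl y).
- by move=> x; rewrite lee_fin heat_kernel_ge0.
rewrite -(integral_normal_pdf (thead y) (Num.sqrt (2 * t))).
apply: eq_integral => a _.
under eq_integral do rewrite heat_kernel_tcons// EFinM.
rewrite ge0_integralZl_EFin//.
- by rewrite IH mule1.
- by move=> x _; rewrite lee_fin heat_kernel_ge0.
- apply/measurable_EFinP.
  exact: measurableT_comp (@measurable_heat_kernel n t) (measurable_tsubl _).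
- exact: normal_pdf_ge0.
Qed.

Lemma tsubx0 n (x : Rn n) : tsub x [tuple 0 | i < n] = x.
Proof. by apply: eq_from_tnth => i; rewrite !tnth_mktuple subr0. Qed.

Lemma integral_heat_kernel n t : 0 < t ->
  (\int[lebesgue_Rn n]_x (heat_kernel t x)%:E = 1)%E.
Proof.
move=> t0; rewrite -(integral_heat_kernel_tsub [tuple 0 | i < n] t0).
by apply: eq_integral => x _; rewrite tsubx0.
Qed.

(** All three kernels in [heat_kernel_dist_le] have mass 1, so integration gives I + 2 c <= 2 for
    the L^1 distance I and the common mass c; [common_mass_ge] bounds 2 - 2 c by the defect. *)
Lemma integral_heat_kernel_dist n tau sig del (y : Rn n) :
  0 < tau -> tau <= sig -> 0 < del ->
  (\int[lebesgue_Rn n]_x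
     `|heat_kernel tau (tsub x y) - heat_kernel sig x|%:E <=
   (Num.min 2 (kernel_defect tau sig del y))%:E)%E.
Proof.
move=> tau0 tausig del0.
have sig0 : 0 < sig by exact: lt_le_trans tausig.
have d0 : 0 < tau / (1 + del) by rewrite divr_gt0// addr_gt0.
have mA : measurable_fun setT (fun x => heat_kernel tau (tsub x y)).
  exact: measurableT_comp (@measurable_heat_kernel n tau) (measurable_tsubl y).
have mB := @measurable_heat_kernel n sig.
have mC := @measurable_heat_kernel n (tau / (1 + del)).
pose c := common_mass tau sig del y.
have c0 : 0 <= c by rewrite mulr_ge0 ?expR_ge0 ?powR_ge0.
have mD : measurable_fun setT
    (fun x => `|heat_kernel tau (tsub x y) - heat_kernel sig x|%:E).
  by apply/measurable_EFinP/measurableT_comp => //; exact: measurable_funB.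
have mcC : measurable_fun setT
    (fun x : Rn n => (2 * c * heat_kernel (tau / (1 + del)) x)%:E).
  by apply/measurable_EFinP/measurable_funM.
have mEA : measurable_fun setT (fun x => (heat_kernel tau (tsub x y))%:E).
  exact/measurable_EFinP.
have mEB : measurable_fun setT (fun x : Rn n => (heat_kernel sig x)%:E).
  exact/measurable_EFinP.
set I := (\int[_]_x _)%E.
(* Stated as a sum because I is not yet known to be finite. *)
have key : (I + (2 * c)%:E <= 2%:E)%E.
  have <- : (\int[lebesgue_Rn n]_x (2 * c * heat_kernel (tau / (1 + del)) x)%:E =
      (2 * c)%:E)%E.
    under eq_integral do rewrite EFinM.
    rewrite ge0_integralZl_EFin ?integral_heat_kernel ?mule1//.
    - by move=> x _; rewrite lee_fin heat_kernel_ge0.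
    - exact/measurable_EFinP.
    - by rewrite mulr_ge0.
  rewrite /I -ge0_integralD//; last first.
  - by move=> x _; rewrite lee_fin mulr_ge0 ?heat_kernel_ge0// mulr_ge0.
  have -> : (2%:E = \int[lebesgue_Rn n]_x (heat_kernel tau (tsub x y) +
      heat_kernel sig x)%:E)%E.
    under eq_integral do rewrite EFinD.
    rewrite ge0_integralD//.
    - by rewrite integral_heat_kernel ?integral_heat_kernel_tsub.
    - by move=> x _; rewrite lee_fin heat_kernel_ge0.
    - by move=> x _; rewrite lee_fin heat_kernel_ge0.
  apply: ge0_le_integral => //.
  - by move=> x _; rewrite -EFinD lee_fin addr_ge0// mulr_ge0 ?heat_kernel_ge0// mulr_ge0.
  - exact: emeasurable_funD.
  - by apply/measurable_EFinP/measurable_funD.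
  - by move=> x _; rewrite -EFinD lee_fin -mulrA heat_kernel_dist_le.
have I0 : (0 <= I)%E by apply: integral_ge0 => x _; rewrite lee_fin.
have := common_mass_ge y tau0 tausig del0; rewrite -/c.
move: I0 key; case: I => [i| |]//=.
rewrite -EFinD !lee_fin le_min => i0 key hc.
by apply/andP; split; lra.
Qed.

End heat_kernel_mass.

(** * Deviation of the heat flow from its mass times a kernel *)

Section heat_deviation.
Context {R : realType}.
Local Notation Rn n := (n.-tuple (measurableTypeR R)).
Implicit Types (n : nat) (t tau sig del : R).

(** The cap 2 makes the weight times |w| integrable without moments of w. The absolute value keeps
    the weight nonnegative for every [tau], also for negative ones, which occur as t - s when s
    exceeds t. *)
Definition defect_weight n tau sig del (y : Rn n) : R :=
  Num.min 2 `|kernel_defect tau sig del y|.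

Lemma defect_weight_ge0 n tau sig del (y : Rn n) : 0 <= defect_weight tau sig del y.
Proof. by rewrite le_min normr_ge0 andbT. Qed.

Lemma defect_weight_le2 n tau sig del (y : Rn n) : defect_weight tau sig del y <= 2.
Proof. by rewrite ge_min lexx. Qed.

Lemma measurable_defect_weight n tau sig del :
  measurable_fun setT (@defect_weight n tau sig del).
Proof.
apply: measurable_minr => //; apply: measurableT_comp => //.
apply: measurable_funD => //; apply: measurable_funM => //.
apply: measurable_funM => //; apply: measurable_funM => //.
exact: measurable_sqnorm.
Qed.

Definition weighted_defect n tau sig del (w : Rn n -> R) : \bar R :=
  (\int[lebesgue_Rn n]_y (defect_weight tau sig del y * `|w y|)%:E)%E.

(** For integrable w and tau > 0 this is e^(tau Delta) w minus the mass of w times G(sig), by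
    [heat_semigroup_deviation]. The single integral keeps the difference of kernels together and
    avoids a difference of extended reals. *)
Definition heat_deviation n tau sig (w : Rn n -> R) (x : Rn n) : \bar R :=
  (\int[lebesgue_Rn n]_y
     ((heat_kernel tau (tsub x y) - heat_kernel sig x) * w y)%:E)%E.

Lemma measurable_deviation_integrand n tau sig (w : Rn n -> R) :
  measurable_fun setT w ->
  measurable_fun setT (fun p : Rn n * Rn n =>
    ((heat_kernel tau (tsub p.1 p.2) - heat_kernel sig p.1) * w p.2)%:E).
Proof.
move=> mw; apply/measurable_EFinP/measurable_funM.
  apply: measurable_funB; first exact: measurable_heat_kernel_tsub.
  exact: (measurableT_comp (@measurable_heat_kernel R n sig) measurable_fst).
exact: measurableT_comp.
Qed.

(** Tonelli's theorem gives measurability for the positive and negative parts, and a difference of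
    measurable extended real functions is measurable, so integrability of the sections is not at
    issue. *)
Lemma measurable_fun_integral_section d1 d2 (T1 : measurableType d1)
    (T2 : measurableType d2) (m2 : {sigma_finite_measure set T2 -> \bar R})
    (f : T1 * T2 -> \bar R) :
  measurable_fun setT f -> measurable_fun setT (fun x => \int[m2]_y f (x, y))%E.
Proof.
move=> mf; rewrite (_ : (fun _ => _) = (fun x =>
    fubini_F m2 f^\+ x - fubini_F m2 f^\- x)%E); last first.
  by apply/funext => x; rewrite [LHS]integralE /fubini_F; congr (_ - _)%E; apply: eq_integral => y _; rewrite ?funeposE ?funenegE.
apply: emeasurable_funB.
  by apply: measurable_fun_fubini_tonelli_F => //; exact: measurable_funepos.
by apply: measurable_fun_fubini_tonelli_F => //; exact: measurable_funeneg.
Qed.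

Lemma measurable_heat_deviation n tau sig (w : Rn n -> R) :
  measurable_fun setT w -> measurable_fun setT (heat_deviation tau sig w).
Proof.
move=> mw; exact: (measurable_fun_integral_section (lebesgue_Rn n)
  (measurable_deviation_integrand tau sig mw)).
Qed.

Lemma weighted_defect_ge0 n tau sig del (w : Rn n -> R) :
  (0 <= weighted_defect tau sig del w)%E.
Proof.
by apply: integral_ge0 => y _; rewrite lee_fin mulr_ge0 ?defect_weight_ge0.
Qed.

Lemma measurable_weighted_defect_integrand n tau sig del (w : Rn n -> R) :
  measurable_fun setT w ->
  measurable_fun setT (fun y => (defect_weight tau sig del y * `|w y|)%:E).
Proof.
move=> mw; apply/measurable_EFinP/measurable_funM => //.
  exact: measurable_defect_weight.
exact: measurableT_comp.
Qed.

Lemma weighted_defect_le n tau sig del (w : Rn n -> R) :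
  measurable_fun setT w ->
  (weighted_defect tau sig del w <= 2%:E * \int[lebesgue_Rn n]_y `|w y|%:E)%E.
Proof.
move=> mw.
have maw : measurable_fun setT (fun y => `|w y|%:E).
  by apply/measurable_EFinP; exact: measurableT_comp.
rewrite -ge0_integralZl_EFin//.
apply: ge0_le_integral => //.
- by move=> y _; rewrite lee_fin mulr_ge0 ?defect_weight_ge0.
- exact: measurable_weighted_defect_integrand.
- by apply: measurable_funeM.
- by move=> y _; rewrite -EFinM lee_fin ler_wpM2r ?defect_weight_le2.
Qed.

(** Tonelli's theorem lets x be integrated first at fixed y, which leaves the L^1 distance of the
    two kernels times |w y|. *)
Lemma heat_deviation_L1 n tau sig del (w : Rn n -> R) :
  measurable_fun setT w -> 0 < tau -> tau <= sig -> 0 < del ->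
  (\int[lebesgue_Rn n]_x `|heat_deviation tau sig w x| <=
   weighted_defect tau sig del w)%E.
Proof.
move=> mw tau0 tausig del0.
have mD := measurable_deviation_integrand tau sig mw.
have maD : measurable_fun setT (fun p : Rn n * Rn n =>
    `|(heat_kernel tau (tsub p.1 p.2) - heat_kernel sig p.1) * w p.2|%:E).
  apply/measurable_EFinP; apply: measurableT_comp => //.
  exact/measurable_EFinP.
apply: (@le_trans _ _ (\int[lebesgue_Rn n]_x \int[lebesgue_Rn n]_y
   `|(heat_kernel tau (tsub x y) - heat_kernel sig x) * w y|%:E)%E).
  apply: ge0_le_integral => //.
  - by apply: measurableT_comp => //; exact: measurable_heat_deviation.
  - apply: (measurable_fun_integral_section (lebesgue_Rn n) (f := fun p =>
      `|(heat_kernel tau (tsub p.1 p.2) - heat_kernel sig p.1) * w p.2|%:E)).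
    exact: maD.
  - move=> x _; apply: le_abse_integral => //.
    exact: (measurableT_comp mD (measurable_pair1 x)).
rewrite (fubini_tonelli (fun p : Rn n * Rn n =>
  `|(heat_kernel tau (tsub p.1 p.2) - heat_kernel sig p.1) * w p.2|%:E))//.
apply: ge0_le_integral => //.
- by move=> x _; apply: integral_ge0 => y _; rewrite lee_fin.
- apply: (measurable_fun_fubini_tonelli_G (fun p =>
    `|(heat_kernel tau (tsub p.1 p.2) - heat_kernel sig p.1) * w p.2|%:E)) => //.
- exact: measurable_weighted_defect_integrand.
move=> y _ /=.
under eq_integral do rewrite normrM EFinM.
rewrite ge0_integralZr//; last first.
  apply/measurable_EFinP/measurableT_comp => //; apply: measurable_funB.
    exact: measurableT_comp (@measurable_heat_kernel R n tau) (measurable_tsubl y).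
  exact: measurable_heat_kernel.
rewrite EFinM lee_wpmul2r//.
apply: le_trans (integral_heat_kernel_dist y tau0 tausig del0) _.
by rewrite lee_fin le_min !ge_min lexx /= ler_norm orbT.
Qed.

Lemma heat_deviation_sup n tau sig del (w : Rn n -> R) (x : Rn n) :
  measurable_fun setT w -> 0 < tau -> tau <= sig -> 0 < del ->
  (`|heat_deviation tau sig w x| <=
   ((4 * pi * tau) `^ (- (n%:R / 2)))%:E * weighted_defect tau sig del w)%E.
Proof.
move=> mw tau0 tausig del0.
have mD := measurableT_comp (measurable_deviation_integrand tau sig mw)
  (measurable_pair1 x).
apply: le_trans (le_abse_integral _ _ mD) _ => //.
have mW := measurable_weighted_defect_integrand tau sig del mw.
rewrite -ge0_integralZl_EFin ?powR_ge0//; last first.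
  by move=> y _; rewrite lee_fin mulr_ge0 ?defect_weight_ge0.
apply: ge0_le_integral => //.
- exact: measurableT_comp.
- by apply: measurable_funeM.
move=> y _ /=; rewrite -EFinM lee_fin normrM mulrA ler_wpM2r//.
apply: le_trans (heat_kernel_dist_sup x y tau0 tausig del0) _.
rewrite ler_wpM2l ?powR_ge0// le_min !ge_min ler_norm orbT andbT.
by rewrite ler1n.
Qed.

Lemma tsubC_sqnorm n (x y : Rn n) : sqnorm (tsub x y) = sqnorm (tsub y x).
Proof. by apply: eq_bigr => i _; rewrite !tnth_mktuple -sqrrN opprB. Qed.

Lemma integral_heat_kernel_tsubr n t (x : Rn n) : 0 < t ->
  (\int[lebesgue_Rn n]_y (heat_kernel t (tsub x y))%:E = 1)%E.
Proof.
move=> t0; rewrite -(integral_heat_kernel_tsub x t0).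
by apply: eq_integral => y _; rewrite /heat_kernel tsubC_sqnorm.
Qed.

Lemma measurable_heat_convolution n tau (w : Rn n -> R) (x : Rn n) :
  measurable_fun setT w ->
  measurable_fun setT (fun y => heat_kernel tau (tsub x y) * w y).
Proof.
move=> mw; apply: measurable_funM => //.
exact: measurableT_comp (@measurable_heat_kernel R n tau) (measurable_tsubr x).
Qed.

Lemma integrable_heat_convolution n tau (w : Rn n -> R) (x : Rn n) :
  0 < tau -> (lebesgue_Rn n).-integrable setT (EFin \o w) ->
  (lebesgue_Rn n).-integrable setT
    (fun y => (heat_kernel tau (tsub x y) * w y)%:E).
Proof.
move=> tau0 iw.
have mw : measurable_fun setT w by apply/measurable_EFinP; case/integrableP: iw.
pose c := (4 * pi * tau) `^ (- (n%:R / 2)).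
apply: (@le_integrable _ _ _ _ _ _ _ (fun y => c%:E * (EFin \o w) y)%E) => //.
- by apply/measurable_EFinP; exact: measurable_heat_convolution.
- move=> y _; rewrite /= lee_fin !normrM ler_wpM2r//.
  by rewrite !ger0_norm ?heat_kernel_ge0 ?powR_ge0 ?heat_kernel_sup.
- exact: integrableZl.
Qed.

Lemma heat_semigroup_deviation n tau sig (w : Rn n -> R) (x : Rn n) :
  0 < tau -> (lebesgue_Rn n).-integrable setT (EFin \o w) ->
  (heat_semigroup tau w x = heat_deviation tau sig w x +
    (heat_kernel sig x)%:E * \int[lebesgue_Rn n]_y (w y)%:E)%E.
Proof.
move=> tau0 iw; have ic := integrable_heat_convolution x tau0 iw.
have iG : (lebesgue_Rn n).-integrable setT
    (fun y => (heat_kernel sig x * w y)%:E).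
  exact: (@integrableZl _ _ _ _ _ measurableT (heat_kernel sig x) _ iw).
rewrite /heat_deviation.
under [X in (_ = X + _)%E]eq_integral do rewrite mulrBl EFinB.
rewrite integralB_EFin// /heat_semigroup -integralZl//.
by rewrite subeK// integrable_fin_num.
Qed.

Lemma heat_deviation_fin_num n tau sig (w : Rn n -> R) (x : Rn n) :
  0 < tau -> (lebesgue_Rn n).-integrable setT (EFin \o w) ->
  heat_deviation tau sig w x \is a fin_num.
Proof.
move=> tau0 iw; have ic := integrable_heat_convolution x tau0 iw.
have iG : (lebesgue_Rn n).-integrable setT
    (fun y => (heat_kernel sig x * w y)%:E).
  exact: (@integrableZl _ _ _ _ _ measurableT (heat_kernel sig x) _ iw).
rewrite /heat_deviation; under eq_integral do rewrite mulrBl EFinB.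
by apply: integrable_fin_num => //; exact: integrableB.
Qed.

Lemma heat_semigroup_le n tau (w : Rn n -> R) (x : Rn n) (B : R) :
  measurable_fun setT w -> 0 < tau -> 0 <= B ->
  {ae lebesgue_Rn n, forall y, `|w y| <= B} ->
  (`|heat_semigroup tau w x| <= B%:E)%E.
Proof.
move=> mw tau0 B0 wB.
have mc := measurable_heat_convolution tau x mw.
apply: le_trans (le_abse_integral _ _ _) _ => //; first exact/measurable_EFinP.
have mk : measurable_fun setT (fun y => (heat_kernel tau (tsub x y))%:E).
  apply/measurable_EFinP.
  exact: measurableT_comp (@measurable_heat_kernel R n tau) (measurable_tsubr x).
rewrite -[leRHS]mule1 -(integral_heat_kernel_tsubr x tau0).
rewrite -ge0_integralZl_EFin//; last by move=> y _; rewrite lee_fin heat_kernel_ge0.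
apply: ae_ge0_le_integral => //.
- by apply/measurable_EFinP/measurableT_comp.
- by move=> y _; rewrite -EFinM lee_fin mulr_ge0 ?heat_kernel_ge0.
- by apply: measurable_funeM.
apply: filterS wB => y wB _ /=.
rewrite -EFinM lee_fin normrM ger0_norm ?heat_kernel_ge0// mulrC.
by rewrite ler_wpM2r ?heat_kernel_ge0.
Qed.

(** The heat flow does not increase the sup norm, so no negative power of [tau] appears and the
    bound survives as [tau] tends to 0. *)
Lemma heat_deviation_le n tau sig (w : Rn n -> R) (x : Rn n) (B : R) :
  0 < tau -> 0 < sig -> 0 <= B ->
  (lebesgue_Rn n).-integrable setT (EFin \o w) ->
  {ae lebesgue_Rn n, forall y, `|w y| <= B} ->
  (`|heat_deviation tau sig w x| <=
   B%:E + ((4 * pi * sig) `^ (- (n%:R / 2)))%:E *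
     \int[lebesgue_Rn n]_y `|w y|%:E)%E.
Proof.
move=> tau0 sig0 B0 iw wB.
have mw : measurable_fun setT w by apply/measurable_EFinP; case/integrableP: iw.
have iwf := integrable_fin_num measurableT iw.
have -> : (heat_deviation tau sig w x = heat_semigroup tau w x -
    (heat_kernel sig x)%:E * \int[lebesgue_Rn n]_y (w y)%:E)%E.
  by rewrite (heat_semigroup_deviation sig)// addeK// fin_numM.
apply: le_trans (lee_abs_sub _ _) _; apply: leeD.
  exact: heat_semigroup_le.
rewrite abseM /= lee_pmul ?lee_fin//.
  by rewrite ger0_norm ?heat_kernel_ge0 ?heat_kernel_sup.
apply: le_abse_integral => //; exact/measurable_EFinP.
Qed.

End heat_deviation.

(** * Limits of integrals of products, and joint measurability *)

Section measure_limits.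
Context {R : realType}.

Section cvg_integral_mul.
Context {d : measure_display} {T : measurableType d}.
Variable mu : {measure set T -> \bar R}.

(** k_j w_j = k_j (w_j - w) + k_j w: the first term is small in L^1 because |k_j| <= C, the second
    converges by domination with C |w|. *)
Let cvg_integral_mul_forall (k_ w_ : nat -> T -> R) (k w : T -> R) (C : R) :
  (forall j, measurable_fun setT (k_ j)) -> measurable_fun setT k ->
  (forall j x, `|k_ j x| <= C) ->
  (forall x, k_ ^~ x @ \oo --> k x) ->
  (forall j, mu.-integrable setT (EFin \o w_ j)) ->
  mu.-integrable setT (EFin \o w) ->
  (\int[mu]_x `|w_ j x - w x|%:E)%E @[j --> \oo] --> 0%E ->
  (\int[mu]_x (k_ j x * w_ j x)%:E)%E @[j --> \oo] -->
  (\int[mu]_x (k x * w x)%:E)%E.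
Proof.
move=> mk_ mk kC kk iw_ iw ww.
have mw_ j : measurable_fun setT (w_ j).
  by apply/measurable_EFinP; case/integrableP: (iw_ j).
have mw : measurable_fun setT w by apply/measurable_EFinP; case/integrableP: iw.
have ib (f : T -> R) j : mu.-integrable setT (EFin \o f) ->
    mu.-integrable setT (fun x => (k_ j x * f x)%:E).
  move=> fi; have mf : measurable_fun setT f.
    by apply/measurable_EFinP; case/integrableP: fi.
  apply: (@le_integrable _ _ _ _ _ _ _ (fun x => C%:E * (EFin \o f) x)%E) => //.
  - by apply/measurable_EFinP; exact: measurable_funM.
  - move=> x _; rewrite /= lee_fin !normrM ler_wpM2r//.
    by rewrite (le_trans (kC j x)) ?ler_norm.
  - exact: integrableZl.
have iwB j : mu.-integrable setT (EFin \o (w_ j \- w)).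
  have := integrableB measurableT (iw_ j) iw.
  by apply: eq_integrable => // x _; rewrite /= EFinB.
have -> : (fun j => \int[mu]_x (k_ j x * w_ j x)%:E)%E =
    (fun j => \int[mu]_x (k_ j x * (w_ j x - w x))%:E +
              \int[mu]_x (k_ j x * w x)%:E)%E.
  apply/funext => j; rewrite -integralD_EFin//.
  - by apply: eq_integral => x _; rewrite -EFinD -mulrDr subrK.
  - exact: (ib _ j (iwB j)).
  - exact: (ib _ j iw).
rewrite -[X in _ --> X]add0e; apply: cvgeD => //.
- apply/cvg_abse0P.
  apply: (@squeeze_cvge _ _ _ _ (cst 0%E) _
      (fun j => C%:E * \int[mu]_x `|w_ j x - w x|%:E)%E) => //.
  + near=> j; rewrite /= abse_ge0 /=.
    apply: le_trans (le_abse_integral _ _ _) _ => //.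
      by case/integrableP: (ib _ j (iwB j)).
    have C0 : forall x : T, 0 <= C by move=> x; exact: le_trans (kC j x).
    rewrite -integralZl//; last first.
      have := integrable_abse (iwB j).
      by apply: eq_integrable.
    apply: ge0_le_integral => //.
    * by apply: measurableT_comp => //; case/integrableP: (ib _ j (iwB j)).
    * apply: measurable_funeM; apply/measurable_EFinP.
      by apply: measurableT_comp => //; exact: measurable_funB.
    * by move=> x _; rewrite /= lee_fin normrM ler_wpM2r.
  + exact: cvg_cst.
  + by rewrite -(mule0 C%:E); apply: cvgeZl.
- apply: (@dominated_cvg _ _ _ _ _ _ _ _ (fun x => (C * `|w x|)%:E)) => //.
  + by move=> j; apply/measurable_EFinP/measurable_funM.
  + move=> x _; apply: cvg_EFin; first by near=> j.
    by apply: cvgMl; exact: kk.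
  + have := integrableZl measurableT C (integrable_abse iw).
    by apply: eq_integrable.
  + by move=> j x _; rewrite /= lee_fin normrM ler_wpM2r.
Unshelve. all: by end_near.
Qed.

Lemma cvg_integral_mul (k_ w_ : nat -> T -> R) (k w : T -> R) (C : R) :
  (\forall j \near \oo, [/\ measurable_fun setT (k_ j),
    (forall x, `|k_ j x| <= C) & mu.-integrable setT (EFin \o w_ j)]) ->
  measurable_fun setT k -> (forall x, k_ ^~ x @ \oo --> k x) ->
  mu.-integrable setT (EFin \o w) ->
  (\int[mu]_x `|w_ j x - w x|%:E)%E @[j --> \oo] --> 0%E ->
  (\int[mu]_x (k_ j x * w_ j x)%:E)%E @[j --> \oo] -->
  (\int[mu]_x (k x * w x)%:E)%E.
Proof.
move=> [N _ hN] mk kk iw ww.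
have hN' j : [/\ measurable_fun setT (k_ (j + N)%N),
    (forall x, `|k_ (j + N)%N x| <= C) & mu.-integrable setT (EFin \o w_ (j + N)%N)].
  by apply: hN => /=; rewrite leq_addl.
rewrite -(cvg_shiftn N).
apply: (@cvg_integral_mul_forall (fun j => k_ (j + N)%N) (fun j => w_ (j + N)%N) k w C) => //.
- by move=> j; case: (hN' j).
- by move=> j; case: (hN' j).
- by move=> x; have := kk x; rewrite -(cvg_shiftn N).
- by move=> j; case: (hN' j).
- by move: ww; rewrite -(cvg_shiftn N).
Qed.

End cvg_integral_mul.

Section caratheodory.
Context {d : measure_display} {T : measurableType d}.
Implicit Types (a b s : R) (H : R -> T -> R).

Let grid (j : nat) s : R := (Num.floor (s * j.+1%:R))%:~R / j.+1%:R.

Let cvg_grid s : grid ^~ s @ \oo --> s.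
Proof.
apply: (@squeeze_cvgr _ _ _ _ (fun j => s - j.+1%:R^-1) (cst s)).
- near=> j; rewrite /= /grid ler_pdivlMr// ler_pdivrMr// mulrBl mulVf//.
  have /andP[h1 h2] := floor_itv (s * j.+1%:R).
  by rewrite h1 andbT lerBlDr ltW// (lt_le_trans h2)// intrD.
- rewrite -[X in _ --> X]subr0; apply: cvgB; first exact: cvg_cst.
  exact: cvg_harmonic.
- exact: cvg_cst.
Unshelve. all: by end_near.
Qed.

(** The grid map is constant on each of countably many cells, so a preimage is a countable union of
    rectangles. *)
Let measurable_grid_comp j H : (forall s, measurable_fun setT (H s)) ->
  measurable_fun setT (fun p : measurableTypeR R * T => H (grid j p.1) p.2).
Proof.
move=> mH _ Y mY; rewrite setTI.
have -> : (fun p : measurableTypeR R * T => H (grid j p.1) p.2) @^-1` Y =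
    \bigcup_(k : int) ([set s : measurableTypeR R | (Num.floor (s * j.+1%:R))%:~R = k%:~R :> R] `*`
      [set x | Y (H (k%:~R / j.+1%:R) x)]).
  apply/seteqP; split => [[s x] /= Yx|[s x] /= [k _ [/= sk Yx]]].
    by exists (Num.floor (s * j.+1%:R)).
  by rewrite /grid sk.
apply: countable_bigcupT_measurable => // k; apply: measurableX.
- have := @nondecreasing_measurable R setT
    (fun s => (Num.floor (s * j.+1%:R))%:~R) measurableT.
  have mono : {homo (fun s : R => (Num.floor (s * j.+1%:R))%:~R : R) : x y / x <= y}.
    by move=> x y xy; rewrite ler_int le_floor// ler_wpM2r.
  by move=> /(_ mono) /(_ measurableT [set k%:~R]); rewrite setTI; apply.
- by rewrite -[X in measurable X]setTI; exact: mH.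
Qed.

(** By continuity in s, the function is the pointwise limit of its values at times rounded down to
    the grid of mesh 1 / (j + 1). *)
Lemma measurable_caratheodory a b H :
  (forall s, a < s < b -> measurable_fun setT (H s)) ->
  (forall x s, a < s < b -> {for s, continuous (H ^~ x)}) ->
  measurable_fun setT (fun p : measurableTypeR R * T =>
    if a < p.1 < b then H p.1 p.2 else 0).
Proof.
(* The grid point below s may lie outside the interval, where nothing is known of [H]; the extension
   by 0 is measurable at every time and agrees with [H] near s. *)
move=> mH cH; pose H0 s x := if a < s < b then H s x else 0.
have mH0 s : measurable_fun setT (H0 s).
  by rewrite /H0; case: (boolP (a < s < b)) => // sab; exact: mH.
pose D := [set p : measurableTypeR R * T | a < p.1 < b].
have mD : measurable D.
  rewrite (_ : D = `]a, b[%classic `*` setT); first exact: measurableX.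
  by apply/seteqP; split => [[s x]|[s x]] /=; rewrite in_itv/= => // -[].
have mfD : measurable_fun D (fun p : measurableTypeR R * T => H p.1 p.2).
  apply: (@measurable_fun_cvg _ _ R D (fun j (p : measurableTypeR R * T) => H0 (grid j p.1) p.2)).
    by move=> j; apply: measurable_funTS; exact: measurable_grid_comp.
  move=> [s x] /= sab.
  have : H0 r x @[r --> s] --> H s x.
    have : H r x @[r --> s] --> H s x by exact: cH.
    apply: cvg_trans; apply: near_eq_cvg; near=> r; rewrite /H0 ifT//.
    have : r \in `]a, b[ by near: r; apply: near_in_itvoo; rewrite in_itv.
    by rewrite in_itv.
  by move=> /(cvg_comp _ _ (@cvg_grid s)).
have -> : (fun p : measurableTypeR R * T => if a < p.1 < b then H p.1 p.2 else 0) =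
    (fun p => H p.1 p.2) \_ D.
  apply/funext => -[s x]; rewrite /patch /=; symmetry.
  case: ifPn => [|/negP h]; first by rewrite inE /D /= => ->.
  by rewrite ifF//; apply/negP => sab; apply: h; rewrite inE.
exact: (measurable_restrictT _ mD).1.
Unshelve. all: by end_near.
Qed.

End caratheodory.

End measure_limits.

(** * Continuity in s of the deviation, and decay of the defect for large t *)

Section parameter_limits.
Context {R : realType}.
Local Notation Rn n := (n.-tuple (measurableTypeR R)).
Implicit Types (n : nat) (s t tau sig del : R).

(** Continuity is tested along sequences, which reduces it to [cvg_integral_mul]. *)
Lemma continuous_integral_mul d (T : measurableType d)
    (mu : {measure set T -> \bar R}) (k w : R -> T -> R) (C s0 : R) :
  (\forall s \near s0, [/\ measurable_fun setT (k s),
    (forall x, `|k s x| <= C) & mu.-integrable setT (EFin \o w s)]) ->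
  (forall x, {for s0, continuous (k ^~ x)}) ->
  (\int[mu]_x `|w s x - w s0 x|%:E)%E @[s --> s0] --> 0%E ->
  {for s0, continuous (fun s => fine (\int[mu]_x (k s x * w s x)%:E)%E)}.
Proof.
move=> near_s0 kc wc; have [mk kC iw] := nbhs_singleton near_s0.
apply/(@cvg_nbhsP _ R^o) => u us0.
apply: fine_cvg; rewrite fineK; last first.
  apply: integrable_fin_num => //.
  have mw : measurable_fun setT (w s0).
    by apply/measurable_EFinP; case/integrableP: iw.
  apply: (@le_integrable _ _ _ _ _ _ _ (fun x => C%:E * (EFin \o w s0) x)%E) => //.
  - by apply/measurable_EFinP; exact: measurable_funM.
  - move=> x _; rewrite /= lee_fin !normrM ler_wpM2r//.
    by rewrite (le_trans (kC x)) ?ler_norm.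
  - exact: integrableZl.
apply: (@cvg_integral_mul _ _ _ mu (fun j => k (u j)) (fun j => w (u j)) _ _ C) => //.
- exact: us0 near_s0.
- by move=> x; exact: (cvg_comp _ _ us0 (kc x)).
- exact: (cvg_comp _ _ us0 wc).
Qed.

Lemma continuous_heat_kernel n (x : Rn n) tau : 0 < tau ->
  {for tau, continuous (fun t => heat_kernel t x)}.
Proof.
move=> tau0.
have c4 : {for tau, continuous (fun t => 4 * pi * t : R)}.
  by apply: cvgMr; exact: cvg_id.
have h : (fun t => expR (- (n%:R / 2) * ln (4 * pi * t)) *
    expR (- (sqnorm x / (4 * t)))) @ tau --> heat_kernel tau x.
  rewrite /heat_kernel /powR gt_eqF ?mulr_gt0 ?pi_gt0//.
  apply: cvgM; apply: continuous_cvg; try exact: continuous_expR.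
    apply: cvgMr; apply: continuous_cvg => //.
    by apply: continuous_ln; rewrite !mulr_gt0 ?pi_gt0.
  apply: cvgN; apply: cvgMr; apply: cvgV; first by rewrite gt_eqF ?mulr_gt0.
  by apply: cvgMr; exact: cvg_id.
apply: cvg_trans h; apply: near_eq_cvg; near=> t.
have t0 : 0 < t by near: t; exact: lt_nbhsr.
by rewrite /heat_kernel /powR gt_eqF ?mulr_gt0 ?pi_gt0.
Unshelve. all: by end_near.
Qed.

Lemma continuous_defect_weight n sig del (y : Rn n) tau : 0 < tau ->
  {for tau, continuous (fun t => defect_weight t sig del y)}.
Proof.
move=> tau0.
apply: (@continuous_min _ _ (cst 2) (fun t => `|kernel_defect t sig del y|)).
  exact: cvg_cst.
apply: cvg_norm; apply: cvgD; apply: cvgMr.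
  apply: cvgMr; apply: cvgV; first by rewrite gt_eqF ?mulr_gt0.
  by apply: cvgMr; exact: cvg_id.
apply: cvgB; last exact: cvg_cst.
apply: cvgMr; apply: cvgV; first by rewrite gt_eqF.
exact: cvg_id.
Qed.

(** The origin of the choice del = t^(-1/2): the shift cost is of order |y|^2 / (del t) and the
    dilation exceeds 1 by del + O((1 + s) / t), so this choice makes both O(t^(-1/2)) at fixed s and
    y; s <= t / 2 keeps t - s comparable to t. *)
Lemma defect_weight_le n s t (y : Rn n) : 0 <= s -> 1 <= t -> 2 * s <= t ->
  defect_weight (t - s) (t + 1) (Num.sqrt t)^-1 y <=
  (2 * sqnorm y + n.+1%:R * (2 * (1 + s) + 4)) * (Num.sqrt t)^-1.
Proof.
move=> s0 t1 st; have t0 : 0 < t by lra.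
set r := Num.sqrt t; have r2 : r * r = t by rewrite -expr2 sqr_sqrtr ?ltW.
have r1 : 1 <= r by rewrite -[leLHS]sqrtr1 ler_wsqrtr.
have r0 : 0 < r by lra.
have ts0 : 0 < t - s by lra.
have d0 : 0 < r^-1 by rewrite invr_gt0.
have rV : r * r^-1 = 1 by rewrite mulfV ?gt_eqF.
have dil1 : 1 <= dilation (t - s) (t + 1) r^-1.
  have : 1 + r^-1 <= dilation (t - s) (t + 1) r^-1 by apply: dilation_ge1 => //; lra.
  by apply: le_trans; rewrite lerDl ltW.
have hdil : dilation (t - s) (t + 1) r^-1 - 1 <= (2 * (1 + s) + 4) * r^-1.
  rewrite lerBlDr /dilation ler_pdivrMr//.
  have rt : r <= t by rewrite -r2 ler_peMr ?(ltW r0).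
  have h1 : (s + 3) * t <= (2 * s + 6) * (t - s).
    have -> : (2 * s + 6) * (t - s) = (s + 3) * (2 * (t - s)) by ring.
    by rewrite ler_wpM2l//; lra.
  have h2 : (s + 1) * r <= (s + 1) * t by rewrite ler_wpM2l//; lra.
  have h3 : (s + 1) * r * r^-1 <= ((2 * s + 6) * (t - s) - t - 1) * r^-1.
    by rewrite ler_wpM2r ?(ltW d0)//; lra.
  rewrite -mulrA rV mulr1 in h3.
  lra.
have hshift : shift_cost (t - s) r^-1 y <= sqnorm y * r^-1.
  rewrite /shift_cost invrK ler_pdivrMr ?mulr_gt0//.
  rewrite mulrC -mulrA ler_wpM2l ?sqnorm_ge0//.
  rewrite [leRHS]mulrC ler_pdivlMr// mulrDl mul1r r2.
  have rt : r <= t by rewrite -r2 ler_peMr ?(ltW r0).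
  lra.
rewrite /defect_weight ge_min; apply/orP; right.
rewrite ger0_norm; last first.
  by rewrite /kernel_defect addr_ge0// mulr_ge0 ?subr_ge0// shift_cost_ge0.
rewrite /kernel_defect [leRHS](_ : _ = 2 * (sqnorm y * r^-1) +
  n.+1%:R * ((2 * (1 + s) + 4) * r^-1)); last by ring.
by apply: lerD; rewrite ler_wpM2l.
Qed.

Lemma cvg_defect_weight0 n s (y : Rn n) (u : nat -> R) : 0 <= s ->
  u @ \oo --> +oo ->
  (fun j => defect_weight (u j - s) (u j + 1) (Num.sqrt (u j))^-1 y) @ \oo --> 0.
Proof.
move=> s0 uoo.
pose K := 2 * sqnorm y + n.+1%:R * (2 * (1 + s) + 4).
apply: (@squeeze_cvgr _ _ _ _ (cst 0) (fun j => K * (Num.sqrt (u j))^-1)).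
- near=> j; rewrite defect_weight_ge0/= defect_weight_le//.
  + by near: j; move/cvgryPge : uoo; apply.
  + by near: j; move/cvgryPge : uoo; apply.
- exact: cvg_cst.
- rewrite -(mulr0 K); apply: cvgMr; apply/cvgrPdist_lt => e e0.
  near=> j; rewrite sub0r normrN ger0_norm ?invr_ge0 ?sqrtr_ge0//.
  rewrite invf_plt ?posrE//; last first.
    rewrite sqrtr_gt0; near: j; move/cvgryPgt : uoo; apply.
  rewrite -[ltLHS]ger0_norm ?invr_ge0 ?ltW// -sqrtr_sqr ltr_sqrt.
    by near: j; move/cvgryPgt : uoo; apply.
  by near: j; move/cvgryPgt : uoo; apply.
Unshelve. all: by end_near.
Qed.

Lemma cvg_weighted_defect0 n s (w : Rn n -> R) (u : nat -> R) : 0 <= s ->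
  (lebesgue_Rn n).-integrable setT (EFin \o w) -> u @ \oo --> +oo ->
  weighted_defect (u j - s) (u j + 1) (Num.sqrt (u j))^-1 w @[j --> \oo] --> 0%E.
Proof.
move=> s0 iw uoo.
have iaw : (lebesgue_Rn n).-integrable setT (EFin \o (fun y => `|w y|)).
  by have := integrable_abse iw; apply: eq_integrable.
have := @cvg_integral_mul R _ _ (lebesgue_Rn n)
  (fun j => defect_weight (u j - s) (u j + 1) (Num.sqrt (u j))^-1)
  (fun _ y => `|w y|) (cst 0) (fun y => `|w y|) 2.
have -> : (\int[lebesgue_Rn n]_x (cst 0 x * `|w x|)%:E = 0)%E.
  by under eq_integral do rewrite mul0r; rewrite integral0.
apply => //.
- near=> j; split => //; first exact: measurable_defect_weight.
  by move=> y; rewrite ger0_norm ?defect_weight_ge0 ?defect_weight_le2.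
- by move=> y; exact: cvg_defect_weight0.
- under eq_fun do under eq_integral do rewrite subrr normr0.
  by under eq_fun do rewrite integral0; exact: cvg_cst.
Unshelve. all: by end_near.
Qed.

Lemma continuous_comp_subr (f : R -> R) t s :
  {for t - s, continuous f} -> {for s, continuous (fun r => f (t - r))}.
Proof.
move=> cf; apply: (@continuous_comp _ _ _ (fun r => t - r) f) => //.
by apply: cvgB; [exact: cvg_cst|exact: cvg_id].
Qed.

Section time_dependent_source.
Variables (n : nat) (w : R -> Rn n -> R).
Hypothesis iw : forall s, 0 < s -> (lebesgue_Rn n).-integrable setT (EFin \o w s).
Hypothesis cw : forall s0, 0 < s0 ->
  (\int[lebesgue_Rn n]_x `|w s x - w s0 x|%:E)%E @[s --> s0] --> 0%E.

Let near_pos s0 t : 0 < s0 < t -> \forall s \near s0, 0 < s < t.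
Proof.
move=> s0t; near=> s; have : s \in `]0, t[ by near: s; apply: near_in_itvoo; rewrite in_itv.
by rewrite in_itv.
Unshelve. all: by end_near.
Qed.

Lemma continuous_heat_deviation t (x : Rn n) s0 : 0 < s0 < t ->
  {for s0, continuous (fun s => fine (heat_deviation (t - s) (t + 1) (w s) x))}.
Proof.
move=> s0t; have /andP[s00 s0lt] := s0t.
(* Near s0 the time t - s stays above h, away from the singularity of the kernel, which is then
   bounded by [P h]. *)
pose h := (t - s0) / 2; have h0 : 0 < h by rewrite divr_gt0// subr_gt0.
pose P s := (4 * pi * s) `^ (- (n%:R / 2)) : R.
apply: (@continuous_integral_mul _ _ _
  (fun s y => heat_kernel (t - s) (tsub x y) - heat_kernel (t + 1) x) w
  (P h + P (t + 1))).
- near=> s.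
  have ht : h < t - s.
    have : s < (t + s0) / 2.
      by near: s; apply: lt_nbhsl; rewrite ltr_pdivlMr// mulrDr mulr1 ltrD2r.
    by rewrite /h; lra.
  have s0' : 0 < s < t by near: s; exact: near_pos.
  have /andP[sp st] := s0'.
  split; last exact: iw.
    apply: measurable_funB => //.
    exact: measurableT_comp (@measurable_heat_kernel R n (t - s)) (measurable_tsubr x).
  move=> y; rewrite (le_trans (ler_normB _ _))// !ger0_norm ?heat_kernel_ge0//.
  apply: lerD; last by rewrite heat_kernel_sup// addr_gt0// (lt_trans sp).
  rewrite (le_trans (heat_kernel_sup _ _)) ?subr_gt0//.
  rewrite /P !powRN lef_pV2 ?posrE ?powR_gt0 ?mulr_gt0 ?pi_gt0 ?subr_gt0//.
  have hp : 4 * pi * h <= 4 * pi * (t - s).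
    by rewrite ler_pM2l ?mulr_gt0 ?pi_gt0// ltW.
  have h40 : 0 <= 4 * pi * h by rewrite mulr_ge0 ?(ltW h0)// mulr_ge0 ?pi_ge0.
  by apply: ge0_ler_powR => //; rewrite ?nnegrE// (le_trans h40).
- move=> y; apply: cvgB; last exact: cvg_cst.
  apply: (@continuous_comp_subr (fun s => heat_kernel s (tsub x y))).
  by apply: continuous_heat_kernel; rewrite subr_gt0.
- exact: cw.
Unshelve. all: by end_near.
Qed.

Let integrable_normr s : 0 < s ->
  (lebesgue_Rn n).-integrable setT (EFin \o (fun y => `|w s y|)).
Proof.
by move=> s0; have := integrable_abse (iw s0); apply: eq_integrable.
Qed.

Let cvg_normr s0 : 0 < s0 ->
  (\int[lebesgue_Rn n]_x `| `|w s x| - `|w s0 x| |%:E)%E @[s --> s0] --> 0%E.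
Proof.
move=> s00.
have mw s : 0 < s -> measurable_fun setT (w s).
  by move=> sp; apply/measurable_EFinP; case/integrableP: (iw sp).
apply: (@squeeze_cvge _ _ _ _ (cst 0%E) _
  (fun s => \int[lebesgue_Rn n]_x `|w s x - w s0 x|%:E)%E); last 2 first.
- exact: cvg_cst.
- exact: cw.
near=> s; have sp : 0 < s by near: s; exact: lt_nbhsr.
rewrite integral_ge0//=.
apply: ge0_le_integral => //.
- apply/measurable_EFinP; apply: measurableT_comp => //.
  by apply: measurable_funB; apply: measurableT_comp => //; exact: mw.
- apply/measurable_EFinP; apply: measurableT_comp => //.
  by apply: measurable_funB; exact: mw.
- by move=> y _; rewrite lee_fin ler_dist_dist.
Unshelve. all: by end_near.
Qed.

Lemma continuous_weighted_defect t del s0 : 0 < s0 < t ->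
  {for s0, continuous (fun s => fine (weighted_defect (t - s) (t + 1) del (w s)))}.
Proof.
move=> s0t; have /andP[s00 s0lt] := s0t.
apply: (@continuous_integral_mul _ _ _
  (fun s => defect_weight (t - s) (t + 1) del) (fun s y => `|w s y|) 2).
- near=> s; have sp : 0 < s by near: s; exact: lt_nbhsr.
  split; [exact: measurable_defect_weight| |exact: integrable_normr].
  by move=> y; rewrite ger0_norm ?defect_weight_ge0 ?defect_weight_le2.
- move=> y; apply: (@continuous_comp_subr (fun s => defect_weight s (t + 1) del y)).
  by apply: continuous_defect_weight; rewrite subr_gt0.
- exact: cvg_normr.
Unshelve. all: by end_near.
Qed.

Lemma continuous_mass s0 : 0 < s0 ->
  {for s0, continuous (fun s => fine (\int[lebesgue_Rn n]_y (w s y)%:E)%E)}.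
Proof.
move=> s00.
have E s : fine (\int[lebesgue_Rn n]_y (cst 1 y * w s y)%:E)%E =
    fine (\int[lebesgue_Rn n]_y (w s y)%:E)%E.
  by congr fine; apply: eq_integral => y _; rewrite mul1r.
have : {for s0, continuous
    (fun s => fine (\int[lebesgue_Rn n]_y (cst 1 y * w s y)%:E)%E)}.
  apply: (@continuous_integral_mul _ _ _ (fun _ => cst 1) w 1).
  - near=> s; split => //; last by apply: iw; near: s; exact: lt_nbhsr.
    by move=> y; rewrite normr1.
  - by move=> y; exact: cvg_cst.
  - exact: cw.
rewrite /prop_for /continuous_at E => h.
by under eq_fun do rewrite -E.
Unshelve. all: by end_near.
Qed.

End time_dependent_source.

End parameter_limits.

(** * Pointwise estimates of the nonlinearity *)

Section source_term.
Context {R : realType}.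
Implicit Types (n : nat) (v a b : R).

Lemma measurable_source n : measurable_fun setT (@source R n).
Proof.
apply: measurable_funM; last first.
  by apply: measurableT_comp => //; exact: measurable_funX.
apply: measurable_funM => //.
exact: (measurableT_comp (@measurable_powR R _) (@normr_measurable R setT)).
Qed.

Lemma normr_source n v :
  `|source n v| = `|v| `^ (4 / n%:R) * `|v| * expR (v ^+ 2).
Proof. by rewrite /source !normrM (ger0_norm (powR_ge0 _ _)) (ger0_norm (expR_ge0 _)). Qed.

Lemma source_le n v (M : R) : `|v| <= M ->
  `|source n v| <= M `^ (4 / n%:R) * expR (M ^+ 2) * `|v|.
Proof.
move=> vM; have M0 : 0 <= M by exact: le_trans vM.
rewrite normr_source mulrAC ler_wpM2r//.
apply: ler_pM; rewrite ?powR_ge0 ?expR_ge0//.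
  by apply: ge0_ler_powR; rewrite ?nnegrE// divr_ge0.
by rewrite ler_expR -real_normK ?num_real// lerXn2r// nnegrE.
Qed.

Lemma source_small n (e : R) : (1 <= n)%N -> 0 < e ->
  exists2 del : R, 0 < del & forall v, `|v| <= del -> `|source n v| <= e * `|v|.
Proof.
move=> n1 e0.
have n0 : 0 < n%:R :> R by rewrite ltr0n.
(* As q inverts 4/n, the threshold gives |v|^(4/n) <= e / exp(1), while |v| <= 1 gives exp(v^2) <=
   exp(1). *)
pose q : R := n%:R / 4.
have q0 : 0 < q by rewrite divr_gt0.
pose b := e / expR 1 : R; have b0 : 0 < b by rewrite divr_gt0 ?expR_gt0.
have del0 : 0 < Num.min 1 (b `^ q) by rewrite lt_min ltr01 powR_gt0.
exists (Num.min 1 (b `^ q)) => // v vd.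
apply: le_trans (source_le n vd) _; rewrite ler_wpM2r//.
have -> : e = b * expR 1 by rewrite /b divfK// gt_eqF ?expR_gt0.
apply: ler_pM; rewrite ?powR_ge0 ?expR_ge0//.
  apply: (@le_trans _ _ ((b `^ q) `^ (4 / n%:R))).
    apply: ge0_ler_powR; rewrite ?nnegrE ?powR_ge0 ?divr_ge0 ?(ltW del0)//.
    by rewrite ge_min lexx orbT.
  rewrite -powRrM (_ : q * (4 / n%:R) = 1) ?powRr1 ?(ltW b0)//.
  by rewrite /q; field; rewrite gt_eqF.
by rewrite ler_expR exprn_ile1 ?(ltW del0)// ge_min lexx.
Qed.

(** Off 0 the power is exp((4/n) ln |z|); at 0, where this formula is lost, the limit follows from
    superlinearity. *)
Lemma continuous_source n : (1 <= n)%N -> continuous (@source R n).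
Proof.
move=> n1 v; have [->|v0] := eqVneq v 0.
  have s0 : source n 0 = 0 :> R by rewrite /source mulr0 mul0r.
  rewrite /continuous_at s0.
  have [del del0 hdel] := source_small n1 ltr01.
  apply/cvgr0Pnorm_lt => e e0; near=> z.
  have zd : `|z| < Num.min del e.
    near: z.
    have : 0 < Num.min del e by rewrite lt_min del0 e0.
    by move=> m0; apply/nbhs_ballP; exists (Num.min del e) => //= z; rewrite /ball/= sub0r normrN.
  move: zd; rewrite lt_min => /andP[zd ze].
  by rewrite (le_lt_trans (hdel z (ltW zd)))// mul1r.
have h : (fun z : R => expR (4 / n%:R * ln `|z|) * z * expR (z ^+ 2)) @ v --> source n v.
  rewrite /source /powR normr_eq0 (negbTE v0).
  apply: cvgM; last first.
    by apply: continuous_cvg; [exact: continuous_expR|exact: exprn_continuous].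
  apply: cvgM; last exact: cvg_id.
  apply: continuous_cvg; first exact: continuous_expR.
  apply: cvgMr; apply: continuous_cvg; last exact: norm_continuous.
  by apply: continuous_ln; rewrite normr_gt0.
apply: cvg_trans h; apply: near_eq_cvg; near=> z.
rewrite /source /powR normr_eq0 ifF//; apply/negbTE.
near: z; exact: (open_neq v0).
Unshelve. all: by end_near.
Qed.

(** The Heine-Cantor argument on [-M, M], by covering compactness. Only a is confined to the
    interval, so [P] quantifies over every b close to a. *)
Lemma uniform_source n (M e : R) : (1 <= n)%N -> 0 < e ->
  exists2 eta : R, 0 < eta & forall a b, `|a| <= M -> `|a - b| < eta ->
    `|source n a - source n b| < e.
Proof.
move=> n1 e0.
pose P (eta a : R) := forall b : R, `|a - b| < eta -> `|source n a - source n b| < e.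
have local_P (x : R) : \forall a \near x & eta \near 0^'+, P eta a.
  have e20 : 0 < e / 2 by rewrite divr_gt0.
  have /cvgrPdist_lt/(_ _ e20) := @continuous_source n n1 x.
  move=> /nbhs_ballP[r /= r0 hr].
  have r20 : 0 < r / 2 by rewrite divr_gt0.
  exists (ball x (r / 2), [set eta | 0 < eta < r / 2]).
    split => /=; first exact: nbhsx_ballx.
    near=> eta; apply/andP; split; near: eta; [exact: nbhs_right_gt|exact: nbhs_right_lt].
  move=> [a eta] /= [xa /andP[_ etar]] b ab.
  have ha : ball x r a by apply: le_ball xa; lra.
  have xa' : `|x - a| < r / 2 by [].
  have xb : `|x - b| < r by have := ler_distD a x b; lra.
  have := hr _ ha; have := hr b xb => /= h1 h2.
  have := ler_distD (source n x) (source n a) (source n b).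
  by rewrite (distrC (source n a) (source n x)) => h3; lra.
have /compact_near_coveringP/(_ R (0 : R)^'+ P _ (fun x _ => local_P x)) :=
  @segment_compact R (- M) M.
move=> [r /= r0 hr]; exists (r / 2); first by rewrite divr_gt0.
move=> a b aM ab; apply: (hr (r / 2)) => //=.
- by rewrite sub0r normrN ger0_norm ?divr_ge0 ?(ltW r0)// ltr_pdivrMr// ltr_pMr// ltr1n.
- by rewrite divr_gt0.
- by rewrite in_itv/= -ler_norml.
Unshelve. all: by end_near.
Qed.

(* The linear part can be made arbitrarily small because the source is
   superlinear at the origin. *)
Lemma source_modulus n (M e : R) : (1 <= n)%N -> 0 < e ->
  exists2 C : R, 0 <= C & forall a b, `|a| <= M -> `|b| <= M ->
    `|source n a - source n b| <= e * (`|a| + `|b|) + C * (a - b) ^+ 2.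
Proof.
move=> n1 e0; have [d d0 hd] := source_small n1 e0.
(* Unless both |a| and |b| are at most d, |a| + |b| >= d, so a difference below e d is within the
   linear term. *)
have ed0 : 0 < e * d by rewrite mulr_gt0.
have [eta eta0 heta] := @uniform_source n M _ n1 ed0.
pose B := M `^ (4 / n%:R) * expR (M ^+ 2) * M.
have sB a : `|a| <= M -> `|source n a| <= B.
  move=> aM; apply: le_trans (source_le n aM) _.
  by rewrite ler_wpM2l// mulr_ge0 ?powR_ge0 ?expR_ge0.
(* With this constant the quadratic term is at least 2 |B| when |a - b| >= eta, and 2 |B| bounds
   |f(a)| + |f(b)|. *)
have CB : 0 <= 2 * `|B| / eta ^+ 2.
  by apply: divr_ge0; [exact: mulr_ge0|exact: sqr_ge0].
exists (2 * `|B| / eta ^+ 2) => //.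
move=> a b aM bM.
have C0 : 0 <= 2 * `|B| / eta ^+ 2 * (a - b) ^+ 2.
  by apply: mulr_ge0 => //; exact: sqr_ge0.
have ab0 : 0 <= e * (`|a| + `|b|) by rewrite mulr_ge0 ?addr_ge0 ?(ltW e0).
have [abd|abd] := leP (Num.max `|a| `|b|) d.
  move: abd; rewrite ge_max => /andP[ad bd].
  have := hd _ ad; have := hd _ bd; have := ler_normB (source n a) (source n b).
  lra.
have dab : d <= `|a| + `|b|.
  move: abd; rewrite lt_max => /orP[] /ltW h.
    by rewrite (le_trans h)// lerDl.
  by rewrite (le_trans h)// lerDr.
have [h|h] := ltP `|a - b| eta.
  have /ltW hs := heta a b aM h.
  have : e * d <= e * (`|a| + `|b|) by rewrite ler_pM2l.
  lra.
have := ler_normB (source n a) (source n b); have := sB _ aM; have := sB _ bM.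
have BB := ler_norm B.
have : 2 * `|B| <= 2 * `|B| / eta ^+ 2 * (a - b) ^+ 2.
  rewrite -mulrA ler_peMr// mulrC ler_pdivlMr ?exprn_gt0// mul1r.
  by rewrite -[leRHS]real_normK ?num_real// lerXn2r ?nnegrE ?(ltW eta0).
lra.
Qed.

Lemma powR4n_le4 n (z : R) : (1 <= n)%N -> 1 <= z -> z `^ (4 / n%:R) <= z ^+ 4.
Proof.
move=> n1 z1; rewrite -(powR_mulrn 4) ?(le_trans ler01)// ler_powR//.
by rewrite ler_pdivrMr ?ltr0n// ler_peMr// ler1n.
Qed.

(** With z = |v| and E = exp(z^2): z^(4/n) z <= z^6 <= 3! E, hence |f(v)| <= 6 E^2, and E >= 2 gives
    E^2 <= E^4 - 1. *)
Lemma source_ge1_le n v : (1 <= n)%N -> 1 <= `|v| ->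
  `|source n v| <= 6 * (expR (4 * v ^+ 2) - 1).
Proof.
move=> n1 v1; rewrite normr_source -(real_normK (num_real v)).
set z : R := `|v| in v1 *.
have z0 : 0 <= z by lra.
have z2 : 1 <= z ^+ 2 by rewrite exprn_ege1.
have h1 : z `^ (4 / n%:R) * z <= (z ^+ 2) ^+ 3.
  rewrite -exprM [leRHS](_ : _ = z ^+ 4 * z ^+ 2); last by rewrite -exprD.
  apply: ler_pM; rewrite ?powR_ge0 ?powR4n_le4//.
  by rewrite expr2 ler_peMr.
have h2 : (z ^+ 2) ^+ 3 <= 6 * expR (z ^+ 2).
  have := @expR_ge1Dxn R (z ^+ 2) 2 (le_trans ler01 z2).
  rewrite (_ : 3`!%:R = 6)//; lra.
have h3 : 2 <= expR (z ^+ 2) by apply: le_trans (expR_ge1Dx _); lra.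
have -> : expR (4 * z ^+ 2) = expR (z ^+ 2) ^+ 4 by rewrite -expRM_natl.
move: (expR (z ^+ 2)) h2 h3 => E h2 h3.
have E4 : 1 + E ^+ 2 <= E ^+ 4.
  rewrite (_ : E ^+ 4 = E ^+ 2 * E ^+ 2); last by rewrite -exprD.
  have : 4 <= E ^+ 2 by rewrite expr2; nra.
  by move: (E ^+ 2) => y y4; nra.
apply: (@le_trans _ _ (6 * E * E)).
  by rewrite ler_wpM2r ?(le_trans h1)//; lra.
rewrite -mulrA -expr2; lra.
Qed.

(** For |v| < 1 the exponential is at most exp(1), and the power is kept because for n >= 5 it is
    not O(v^2) at 0. *)
Lemma source_le_growth n v : (1 <= n)%N ->
  `|source n v| <= 6 * (expR (4 * v ^+ 2) - 1) +
                   expR 1 * `|v| `^ (4 / n%:R + 1).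
Proof.
move=> n1.
have e0 : 0 <= 6 * (expR (4 * v ^+ 2) - 1).
  by rewrite mulr_ge0// subr_ge0 -[leLHS]expR0 ler_expR mulr_ge0 ?sqr_ge0.
have [v1|v1] := leP 1 `|v|.
  rewrite (le_trans (source_ge1_le n1 v1))// lerDl.
  by rewrite mulr_ge0 ?powR_ge0 ?expR_ge0.
rewrite (@le_trans _ _ (expR 1 * `|v| `^ (4 / n%:R + 1)))//; last by rewrite lerDr.
rewrite normr_source powRD; last first.
  by apply/implyP; rewrite gt_eqF// addr_gt0// divr_gt0 ?ltr0n.
rewrite powRr1// mulrC ler_wpM2r ?mulr_ge0 ?powR_ge0// ler_expR.
by rewrite -real_normK ?num_real// exprn_ile1// ltW.
Qed.

Lemma mul_expR_le (y : R) : 0 <= y -> y * expR y <= 6 * (expR (4 * y) - 1).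
Proof.
move=> y0; have hE : 1 + y <= expR y by exact: expR_ge1Dx.
rewrite [expR (4 * y)]expRM_natl; set E := expR y in hE *.
have E4 : E ^+ 4 - 1 = (E - 1) * (E ^+ 3 + E ^+ 2 + E + 1) by ring.
have E1 : 1 <= E by lra.
have E2 : 0 <= E ^+ 2 by exact: sqr_ge0.
have E3 : 0 <= E ^+ 3 by rewrite exprn_ge0//; lra.
have h : y * E <= (E - 1) * (E ^+ 3 + E ^+ 2 + E + 1) by apply: ler_pM; lra.
have yE : 0 <= y * E by rewrite mulr_ge0//; lra.
by rewrite -E4 in h; lra.
Qed.

(** For n <= 4 and |v| < 1, |v|^(4/n) <= |v|, so |f(v)| <= v^2 exp(v^2) and the rescaled Young
    function alone controls f. *)
Lemma source_le_growth4 n v : (1 <= n <= 4)%N ->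
  `|source n v| <= 6 * (expR (4 * v ^+ 2) - 1).
Proof.
move=> /andP[n1 n4]; have [v1|v1] := leP 1 `|v|; first exact: source_ge1_le.
rewrite normr_source -(real_normK (num_real v)).
set z : R := `|v| in v1 *.
have z0 : 0 <= z by rewrite /z.
have h1 : z `^ (4 / n%:R) <= z.
  rewrite -[leRHS]powRr1//.
  have [->|zp] := eqVneq z 0; first by rewrite !powR0 ?oner_eq0// gt_eqF// divr_gt0 ?ltr0n.
  rewrite ger_powR//; first by rewrite lt0r zp z0 (ltW v1).
  by rewrite ler_pdivlMr ?ltr0n// mul1r ler_nat.
apply: (@le_trans _ _ (z ^+ 2 * expR (z ^+ 2))).
  by rewrite ler_wpM2r ?expR_ge0// expr2 ler_wpM2r.
exact/mul_expR_le/sqr_ge0.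
Qed.

End source_term.

(** * Consequences of a small exp L^2 norm, and interpolation of L^q norms *)

Section orlicz_and_Lnorm.
Context {R : realType}.
Local Notation Rn n := (n.-tuple (measurableTypeR R)).
Implicit Types (n : nat) (t l : R) (q : \bar R).

Lemma measurable_young_integrand n (v : Rn n -> R) l : measurable_fun setT v ->
  measurable_fun setT (fun x => young_exp2 (`|v x| / l)).
Proof.
move=> mv; apply/measurable_EFinP; apply: measurable_funB => //.
apply: measurableT_comp => //; apply: measurable_funX; apply: measurable_funM => //.
exact: measurableT_comp.
Qed.

Lemma young_exp2_ge0 (s : R) : (0 <= young_exp2 s)%E.
Proof. by rewrite lee_fin subr_ge0 -[leLHS]expR0 ler_expR sqr_ge0. Qed.

(** The strict inequality yields an admissible parameter r < l from the infimum, and the integral is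
    nonincreasing in the parameter. *)
Lemma expL2_norm_lt n (v : Rn n -> R) l : measurable_fun setT v ->
  (expL2_norm v < l%:E)%E ->
  (\int[lebesgue_Rn n]_x young_exp2 (`|v x| / l) <= 1)%E.
Proof.
move=> mv /ereal_inf_lt[_ [r [r0 hr] <-]]; rewrite lte_fin => rl.
apply: le_trans hr; apply: ge0_le_integral => //.
- by move=> x _; exact: young_exp2_ge0.
- exact: measurable_young_integrand.
- exact: measurable_young_integrand.
move=> x _; rewrite lee_fin lerD2r ler_expR.
rewrite lerXn2r ?nnegrE ?divr_ge0 ?(ltW r0) ?(ltW (lt_trans r0 rl))//.
by rewrite ler_wpM2l// lef_pV2 ?posrE ?(lt_trans r0 rl)// ltW.
Qed.

(** s^2 <= exp(s^2) - 1, so the exp L^2 norm controls the L^2 norm. *)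
Lemma expL2_norm_lt_integral_sqr n (v : Rn n -> R) l : measurable_fun setT v ->
  0 < l -> (expL2_norm v < l%:E)%E ->
  (\int[lebesgue_Rn n]_x ((v x) ^+ 2)%:E <= (l ^+ 2)%:E)%E.
Proof.
move=> mv l0 /(expL2_norm_lt mv) h.
rewrite -[leRHS]mule1; apply: le_trans (lee_wpmul2l _ h); last first.
  by rewrite lee_fin sqr_ge0.
rewrite -ge0_integralZl_EFin ?sqr_ge0//; last 2 first.
- by move=> x _; exact: young_exp2_ge0.
- exact: measurable_young_integrand.
apply: ge0_le_integral => //.
- by move=> x _; rewrite lee_fin sqr_ge0.
- by apply/measurable_EFinP; exact: measurable_funX.
- by apply: measurable_funeM; exact: measurable_young_integrand.
move=> x _; rewrite -EFinM lee_fin.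
have -> : v x ^+ 2 = l ^+ 2 * (`|v x| / l) ^+ 2.
  by rewrite -exprMn mulrCA mulfV ?gt_eqF// mulr1 real_normK ?num_real.
rewrite ler_wpM2l ?sqr_ge0// lerBrDl; exact: expR_ge1Dx.
Qed.

(** The parameter 1/2 is the origin of the factor 4 in the growth bounds of the source. *)
Lemma expL2_norm_lt_half n (v : Rn n -> R) : measurable_fun setT v ->
  (expL2_norm v < (2^-1)%:E)%E ->
  (\int[lebesgue_Rn n]_x (expR (4 * (v x) ^+ 2) - 1)%:E <= 1)%E.
Proof.
move=> mv /(expL2_norm_lt mv); congr (_ <= _)%E.
apply: eq_integral => x _; rewrite /young_exp2 invrK exprMn real_normK ?num_real//.
by rewrite mulrC (_ : 2 ^+ 2 = 4)// -natrX.
Qed.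

(** A null measure would give the heat kernel the integral 0 instead of 1. The definition of the
    L^oo norm branches on this positivity. *)
Lemma lebesgue_Rn_gt0 n : (0 < @lebesgue_Rn R n setT)%E.
Proof.
rewrite lt0e; apply/andP; split; last exact: measure_ge0.
apply/negP => /eqP m0.
have := @integral_heat_kernel R n 1 ltr01.
rewrite null_set_integral//; first by move=> /eqP; rewrite eq_sym onee_eq0.
by apply/measurable_EFinP; exact: measurable_heat_kernel.
Qed.

Lemma Lnorm_oo_le n (v : Rn n -> R) (B : R) :
  ('N[lebesgue_Rn n]_(+oo)[EFin \o v] <= B%:E)%E <->
  {ae lebesgue_Rn n, forall x, `|v x| <= B}.
Proof.
rewrite unlock /Lnorm lebesgue_Rn_gt0; split.
  by move=> /ess_supP; apply: filterS => x; rewrite /= lee_fin.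
by move=> h; apply/ess_supP; apply: filterS h => x; rewrite /= lee_fin.
Qed.

(** Interpolation: with B = eta t^(-n/2), |g|^r <= B^(r - 1) |g|, so the integral of |g|^r is at
    most B^(r - 1) eta, whose r-th root is eta t^(-(n/2) (1 - 1/r)). *)
Lemma decay_Lnorm_le n q t (eta : R) (g : Rn n -> R) :
  (1 <= q)%E -> 0 < t -> 0 < eta -> measurable_fun setT g ->
  (\int[lebesgue_Rn n]_x `|g x|%:E <= eta%:E)%E ->
  {ae lebesgue_Rn n, forall x, `|g x| <= eta * t `^ (- (n%:R / 2))} ->
  ((t `^ decay_exponent n q)%:E * 'N[lebesgue_Rn n]_q[EFin \o g] <= eta%:E)%E.
Proof.
move=> q1 t0 eta0 mg gL1 gsup.
have tN0 : 0 < t `^ (- (n%:R / 2)) by rewrite powR_gt0.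
case: q q1 => [r| |]//; last first.
  move=> _; rewrite /decay_exponent invey /= subr0 mulr1.
  have := (Lnorm_oo_le g _).2 gsup.
  have Tn0 : (0 <= (t `^ (n%:R / 2))%:E)%E by rewrite lee_fin powR_ge0.
  move=> /(lee_wpmul2l Tn0) /le_trans; apply.
  by rewrite -EFinM lee_fin powRN mulrCA mulfV ?mulr1// gt_eqF ?powR_gt0.
rewrite lee_fin => r1; have r0 : 0 < r by exact: lt_le_trans r1.
rewrite unlock /Lnorm /decay_exponent inver gt_eqF//=.
pose B := eta * t `^ (- (n%:R / 2)); have B0 : 0 < B by rewrite mulr_gt0.
have mag : measurable_fun setT (fun x => `|g x|%:E).
  by apply/measurable_EFinP; exact: measurableT_comp.
have hI : (\int[lebesgue_Rn n]_x (`|g x|%:E `^ r) <= (B `^ (r - 1) * eta)%:E)%E.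
  rewrite EFinM; apply: le_trans (lee_wpmul2l _ gL1); last by rewrite lee_fin powR_ge0.
  rewrite -ge0_integralZl_EFin ?powR_ge0//.
  apply: ae_ge0_le_integral => //.
  - by move=> x _; exact: poweR_ge0.
  - apply/measurable_EFinP => /=.
    by apply: (measurableT_comp (@measurable_powR R r)); exact: measurableT_comp.
  - by move=> x _; rewrite -EFinM lee_fin mulr_ge0 ?powR_ge0.
  - exact: measurable_funeM.
  apply: filterS gsup => x gx _; rewrite poweR_EFin -EFinM lee_fin.
  have [->|g0] := eqVneq `|g x| 0; first by rewrite powR0 ?mulr0// gt_eqF.
  rewrite -[in leLHS](subrK 1 r) [leLHS]powRD; last by rewrite g0 implybT.
  rewrite powRr1// ler_wpM2r// ge0_ler_powR ?subr_ge0 ?nnegrE//.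
  exact: ltW.
set I := (\int[_]_x _)%E in hI.
rewrite (_ : (\int[_]_x _)%E = I)//.
have I0 : (0 <= I)%E by apply: integral_ge0 => x _; exact: poweR_ge0.
move: I I0 hI => -[i| |]//; rewrite !lee_fin => i0 hi.
rewrite (@le_trans _ _ (t `^ (n%:R / 2 * (1 - r^-1)) * (B `^ (r - 1) * eta) `^ r^-1))//.
  rewrite ler_wpM2l ?powR_ge0//; apply: ge0_ler_powR; rewrite ?nnegrE ?invr_ge0 ?(ltW r0)//.
  by rewrite mulr_ge0 ?powR_ge0 ?ltW.
rewrite powRM ?powR_ge0 ?(ltW eta0)// -powRrM.
have -> : (r - 1) * r^-1 = 1 - r^-1 by rewrite mulrBl mulfV ?gt_eqF// mul1r.
rewrite /B powRM ?(ltW eta0) ?powR_ge0// -powRrM mulNr powRN.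
set T := t `^ _; have T0 : T != 0 by rewrite gt_eqF ?powR_gt0.
rewrite mulrA [T * _]mulrA [T * _]mulrC mulfK//.
rewrite -powRD; last by rewrite subrK oner_eq0.
by rewrite subrK powRr1 ?(ltW eta0).
Qed.

(* The differences of solution values enter quadratically, so they are
   controlled by the L^2 norm, hence by the exp L^2 norm. *)
Lemma source_L1_dist n (a b : Rn n -> R) (M e C : R) :
  measurable_fun setT a -> measurable_fun setT b -> 0 <= e -> 0 <= C ->
  (forall x y, `|x| <= M -> `|y| <= M ->
    `|source n x - source n y| <= e * (`|x| + `|y|) + C * (x - y) ^+ 2) ->
  {ae lebesgue_Rn n, forall x, `|a x| <= M} ->
  {ae lebesgue_Rn n, forall x, `|b x| <= M} ->
  (\int[lebesgue_Rn n]_x `|source n (a x) - source n (b x)|%:E <=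
   e%:E * (\int[lebesgue_Rn n]_x `|a x|%:E + \int[lebesgue_Rn n]_x `|b x|%:E) +
   C%:E * \int[lebesgue_Rn n]_x ((a x - b x) ^+ 2)%:E)%E.
Proof.
move=> ma mb e0 C0 hmod aM bM.
have maa : measurable_fun setT (fun x => `|a x|%:E).
  by apply/measurable_EFinP; exact: measurableT_comp.
have mab : measurable_fun setT (fun x => `|b x|%:E).
  by apply/measurable_EFinP; exact: measurableT_comp.
have mB : measurable_fun setT (a \- b) by exact: measurable_funB.
have md : measurable_fun setT (fun x => ((a x - b x) ^+ 2)%:E).
  by apply/measurable_EFinP; apply: (@measurable_funX _ _ _ _ (a \- b)).
have mS : measurable_fun setT (fun x => `|a x|%:E + `|b x|%:E)%E.
  exact: emeasurable_funD.
have S0 x : setT x -> (0 <= `|a x|%:E + `|b x|%:E)%E by move=> _; exact: adde_ge0.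
have d0 x : setT x -> (0 <= ((a x - b x) ^+ 2)%:E)%E.
  by move=> _; rewrite lee_fin sqr_ge0.
have meS : measurable_fun setT (fun x => e%:E * (`|a x|%:E + `|b x|%:E))%E.
  exact: measurable_funeM.
have mCd : measurable_fun setT (fun x => C%:E * ((a x - b x) ^+ 2)%:E)%E.
  exact: measurable_funeM.
have eS0 x : setT x -> (0 <= e%:E * (`|a x|%:E + `|b x|%:E))%E.
  by move=> /S0; exact: mule_ge0.
have Cd0 x : setT x -> (0 <= C%:E * ((a x - b x) ^+ 2)%:E)%E.
  by move=> /d0; exact: mule_ge0.
rewrite -ge0_integralD//.
rewrite -ge0_integralZl_EFin// -ge0_integralZl_EFin// -ge0_integralD//.
apply: ae_ge0_le_integral => //.
- apply/measurable_EFinP; apply: measurableT_comp => //.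
  by apply: measurable_funB; apply: (measurableT_comp (@measurable_source R n)).
- by move=> x xT; apply: adde_ge0; [exact: eS0|exact: Cd0].
- exact: emeasurable_funD.
apply: filterS2 aM bM => x ax bx _.
by rewrite lee_fin hmod.
Qed.

End orlicz_and_Lnorm.

(** * Convergence to zero in the extended reals *)

Section cvge0.
Context {R : realType}.

Lemma cvge0_le (I : Type) (F : set_system I) (FF : Filter F) (f : I -> \bar R) :
  (forall e : R, 0 < e -> \forall x \near F, (`|f x| <= e%:E)%E) ->
  f x @[x --> F] --> 0%E.
Proof.
move=> h; apply/fine_cvgP; split.
  apply: filterS (h 1 ltr01) => x fx; rewrite fin_num_abs.
  exact: le_lt_trans fx (ltry _).
apply/cvgrPdist_le => e e0; apply: filterS (h e e0) => x /=.
rewrite sub0r normrN; case: (f x) => [r| |] /= fx.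
- by move: fx; rewrite lee_fin.
- by rewrite normr0 ltW.
- by rewrite normr0 ltW.
Qed.

Lemma cvge0_lt (I : Type) (F : set_system I) (FF : Filter F) (f : I -> \bar R) (l : R) :
  0 < l -> f x @[x --> F] --> 0%E -> \forall x \near F, (f x < l%:E)%E.
Proof.
move=> l0 f0; apply: (f0 [set y | (y < l%:E)%E]).
by apply: open_nbhs_nbhs; split; [exact: open_ereal_lt_ereal|rewrite /= lte_fin].
Qed.

End cvge0.

(** * The source along the solution: decay in time and continuity in L^1 *)

Section source_bounds.
Context {R : realType}.
Local Notation Rn n := (n.-tuple (measurableTypeR R)).

Lemma source_L1_le n (v : Rn n -> R) (M : R) : measurable_fun setT v -> 0 <= M ->
  {ae lebesgue_Rn n, forall x, `|v x| <= M} ->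
  (\int[lebesgue_Rn n]_x `|source n (v x)|%:E <=
   (M `^ (4 / n%:R) * expR (M ^+ 2))%:E * \int[lebesgue_Rn n]_x `|v x|%:E)%E.
Proof.
move=> mv M0 vM.
have c0 : 0 <= M `^ (4 / n%:R) * expR (M ^+ 2) by rewrite mulr_ge0 ?powR_ge0 ?expR_ge0.
have mav : measurable_fun setT (fun x => `|v x|%:E).
  by apply/measurable_EFinP; exact: measurableT_comp.
rewrite -ge0_integralZl_EFin//.
apply: ae_ge0_le_integral => //.
- apply/measurable_EFinP; apply: measurableT_comp => //.
  exact: (measurableT_comp (@measurable_source R n)).
- by move=> x _; rewrite -EFinM lee_fin mulr_ge0.
- exact: measurable_funeM.
by apply: filterS vM => x vx _; rewrite lee_fin source_le.
Qed.

Lemma source_L1_growth n (v : Rn n -> R) (K : R) : (1 <= n)%N -> measurable_fun setT v ->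
  (expL2_norm v < (2^-1)%:E)%E ->
  ((5 <= n)%N -> \int[lebesgue_Rn n]_x (`|v x| `^ (4 / n%:R + 1))%:E <= K%:E)%E ->
  0 <= K ->
  (\int[lebesgue_Rn n]_x `|source n (v x)|%:E <= (6 + expR 1 * K)%:E)%E.
Proof.
move=> n1 mv /(expL2_norm_lt_half mv) hexp hK K0.
have ms : measurable_fun setT (fun x => `|source n (v x)|%:E).
  apply/measurable_EFinP; apply: measurableT_comp => //.
  exact: (measurableT_comp (@measurable_source R n)).
have mE : measurable_fun setT (fun x => (expR (4 * (v x) ^+ 2) - 1)%:E).
  apply/measurable_EFinP; apply: measurable_funB => //.
  apply: measurableT_comp => //; apply: measurable_funM => //.
  exact: measurable_funX.
have E0 x : setT x -> (0 <= (expR (4 * (v x) ^+ 2) - 1)%:E)%E.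
  by move=> _; rewrite lee_fin subr_ge0 -[leLHS]expR0 ler_expR mulr_ge0 ?sqr_ge0.
have hexp6 : (6%:E * \int[lebesgue_Rn n]_x (expR (4 * (v x) ^+ 2) - 1)%:E <= 6%:E)%E.
  by rewrite -[leRHS]mule1 lee_wpmul2l.
have m6E : measurable_fun setT (fun x => 6%:E * (expR (4 * (v x) ^+ 2) - 1)%:E)%E.
  exact: measurable_funeM.
have [n5|n5] := leqP 5 n; last first.
  apply: (@le_trans _ _ 6%:E); last first.
    by rewrite lee_fin lerDl mulr_ge0 ?expR_ge0.
  apply: le_trans hexp6; rewrite -ge0_integralZl_EFin//.
  apply: ge0_le_integral => //.
  by move=> x _; rewrite lee_fin source_le_growth4// n1 -ltnS.
have e10 : (0 <= (expR 1 : R)%:E)%E by rewrite lee_fin expR_ge0.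
rewrite EFinD EFinM; apply: le_trans (leeD hexp6 (lee_wpmul2l e10 (hK n5))).
have mP : measurable_fun setT (fun x => (`|v x| `^ (4 / n%:R + 1))%:E).
  apply/measurable_EFinP.
  by apply: (measurableT_comp (@measurable_powR R _)); exact: measurableT_comp.
have meP : measurable_fun setT (fun x => (expR 1)%:E * (`|v x| `^ (4 / n%:R + 1))%:E)%E.
  exact: measurable_funeM.
have P0 x : setT x -> (0 <= (`|v x| `^ (4 / n%:R + 1))%:E)%E.
  by move=> _; rewrite lee_fin powR_ge0.
have E60 x : setT x -> (0 <= 6%:E * (expR (4 * (v x) ^+ 2) - 1)%:E)%E.
  by move=> /E0; exact: mule_ge0.
have eP0 x : setT x -> (0 <= (expR 1)%:E * (`|v x| `^ (4 / n%:R + 1))%:E)%E.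
  by move=> /P0; apply: mule_ge0; rewrite lee_fin expR_ge0.
rewrite -ge0_integralZl_EFin// -ge0_integralZl_EFin ?expR_ge0// -ge0_integralD//.
apply: ge0_le_integral => //; first exact: emeasurable_funD.
by move=> x _; rewrite lee_fin source_le_growth.
Qed.

Section along_solution.
Variables (n : nat) (u : R -> Rn n -> R) (C1 Ci : R).
Hypothesis n1 : (1 <= n)%N.
Hypothesis mu_ : forall t : R, 0 < t -> measurable_fun setT (u t).
Hypothesis C10 : 0 <= C1.
Hypothesis Ci0 : 0 <= Ci.
Hypothesis uL1 : forall t : R, 0 < t -> (\int[lebesgue_Rn n]_x `|u t x|%:E <= C1%:E)%E.
Hypothesis usup : forall t : R, 0 < t ->
  {ae lebesgue_Rn n, forall x, `|u t x| <= Ci * t `^ (- (n%:R / 2))}.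
Hypothesis uexp : forall t : R, 0 < t -> (expL2_norm (u t) < (2^-1)%:E)%E.
Hypothesis uearly : (5 <= n)%N -> exists T K : R, [/\ 0 < T, 0 <= K &
  forall t : R, 0 < t < T ->
    (\int[lebesgue_Rn n]_x (`|u t x| `^ (4 / n%:R + 1))%:E <= K%:E)%E].
Hypothesis ucont : forall t0 : R, 0 < t0 -> expL2_norm (u t \- u t0) @[t --> t0] --> 0%E.

Lemma measurable_source_comp (t : R) : 0 < t -> measurable_fun setT (source n \o u t).
Proof. by move=> t0; apply: (measurableT_comp (@measurable_source R n)); exact: mu_. Qed.

Lemma sup_after (t0 t : R) : 0 < t0 -> t0 <= t ->
  {ae lebesgue_Rn n, forall x, `|u t x| <= Ci * t0 `^ (- (n%:R / 2))}.
Proof.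
move=> t00 t0t; have t0' : 0 < t by exact: lt_le_trans t0t.
apply: filterS (usup t0') => x /le_trans; apply; rewrite ler_wpM2l//.
rewrite !powRN lef_pV2 ?posrE ?powR_gt0//.
by apply: ge0_ler_powR; rewrite ?nnegrE ?divr_ge0// ltW.
Qed.

(** For n <= 4 the exp L^2 bound acts at all times. For n >= 5 it is combined before T with the
    bound on the integral of |u|^(1 + 4/n); after T the sup norm is bounded, so |f(u)| is at most a
    constant times |u|. *)
Lemma source_L1_bounded : exists2 K : R, 0 <= K & forall t : R, 0 < t ->
  (\int[lebesgue_Rn n]_x `|source n (u t x)|%:E <= K%:E)%E.
Proof.
have [n5|n5] := leqP 5 n; last first.
  exists (6 + expR 1 * 0); first by rewrite mulr0 addr0.
  by move=> t t0; apply: source_L1_growth => //; [exact: mu_|exact: uexp|rewrite leqNgt n5].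
have [T [K [T0 K0 hK]]] := uearly n5.
pose M := Ci * T `^ (- (n%:R / 2)).
have M0 : 0 <= M by rewrite mulr_ge0 ?powR_ge0.
pose c := M `^ (4 / n%:R) * expR (M ^+ 2).
have c0 : 0 <= c by rewrite mulr_ge0 ?powR_ge0 ?expR_ge0.
have K60 : 0 <= 6 + expR 1 * K by rewrite addr_ge0// mulr_ge0 ?expR_ge0.
exists (6 + expR 1 * K + c * C1); first by rewrite addr_ge0// mulr_ge0.
move=> t t0; have [tT|Tt] := ltP t T.
  apply: (@le_trans _ _ (6 + expR 1 * K)%:E).
    apply: source_L1_growth => //; [exact: mu_|exact: uexp|move=> _].
    by apply: hK; rewrite t0.
  by rewrite lee_fin lerDl mulr_ge0.
apply: (@le_trans _ _ (c * C1)%:E); last by rewrite lee_fin lerDr.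
apply: le_trans (source_L1_le (mu_ t0) M0 (sup_after T0 Tt)) _.
by rewrite [(c * C1)%:E]EFinM lee_wpmul2l ?lee_fin// uL1.
Qed.

(** The exponent of f matches the decay: (t^(-n/2))^(4/n) = t^(-2). For t >= 1 the exponential
    factor is bounded by exp(Ci^2). *)
Let late (t : R) : 1 <= t -> {ae lebesgue_Rn n, forall x,
  `|source n (u t x)| <= Ci `^ (4 / n%:R) * expR (Ci ^+ 2) * t ^- 2 * `|u t x|}.
Proof.
move=> t1; have t0 : 0 < t by exact: lt_le_trans t1.
apply: filterS (usup t0) => x ux.
apply: le_trans (source_le n ux) _; rewrite ler_wpM2r//.
have tN1 : t `^ (- (n%:R / 2)) <= 1.
  rewrite powRN invf_le1 ?powR_gt0// -[leLHS](powRr0 t) ler_powR//.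
have tp : (t `^ (- (n%:R / 2))) `^ (4 / n%:R) = t ^- 2.
  rewrite -powRrM (_ : _ * _ = - 2); last by field; rewrite pnatr_eq0 -lt0n.
  by rewrite powRN powR_mulrn ?(ltW t0).
rewrite powRM ?powR_ge0// tp mulrAC ler_wpM2r ?invr_ge0 ?sqr_ge0//.
rewrite ler_wpM2l ?powR_ge0//.
rewrite ler_expR lerXn2r ?nnegrE ?mulr_ge0 ?powR_ge0//.
by rewrite ler_piMr.
Qed.

(** The weight 1 / (1 + t^2) replaces t^(-2) because it stays bounded at 0 and is integrable on the
    half-line. *)
Lemma source_L1_decay : exists2 K : R, 0 <= K & forall t : R, 0 < t ->
  (\int[lebesgue_Rn n]_x `|source n (u t x)|%:E <= (K * (oneDsqr t)^-1)%:E)%E.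
Proof.
have [K K0 hK] := source_L1_bounded.
pose c := Ci `^ (4 / n%:R) * expR (Ci ^+ 2).
have c0 : 0 <= c by rewrite mulr_ge0 ?powR_ge0 ?expR_ge0.
have cC0 : 0 <= c * C1 by rewrite mulr_ge0.
(* The factor 2: 1 + t^2 <= 2 for t <= 1, and 1 + t^2 <= 2 t^2 for t >= 1. *)
exists (2 * (K + c * C1)); first by rewrite mulr_ge0// addr_ge0.
move=> t t0; have oD : 0 < oneDsqr t by rewrite /oneDsqr ltr_pwDl ?sqr_ge0.
have [t1|t1] := leP t 1.
  apply: le_trans (hK t t0) _; rewrite lee_fin ler_pdivlMr//.
  have : oneDsqr t <= 2.
    by rewrite /oneDsqr -[leRHS]/(1 + 1) lerD2l exprn_ile1 ?(ltW t0).
  nra.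
have c2 : 0 <= c * t ^- 2 by rewrite mulr_ge0// invr_ge0 sqr_ge0.
have mau : measurable_fun setT (fun x => `|u t x|%:E).
  by apply/measurable_EFinP; apply: measurableT_comp => //; exact: mu_.
apply: (@le_trans _ _ ((c * t ^- 2)%:E * C1%:E)%E); last first.
  have tE : t ^- 2 * oneDsqr t = t ^- 2 + 1.
    by rewrite /oneDsqr mulrDr mulr1 mulVf// expf_neq0// gt_eqF.
  have t21 : t ^- 2 <= 1 by rewrite invf_le1 ?exprn_gt0// exprn_ege1// ltW.
  rewrite -EFinM lee_fin ler_pdivlMr//.
  rewrite (_ : _ * oneDsqr t = c * C1 * (t ^- 2 * oneDsqr t)); last by ring.
  rewrite tE (@le_trans _ _ (c * C1 * 2))//; last by rewrite mulrC ler_pM2l// lerDr.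
  by rewrite ler_wpM2l//; lra.
apply: (@le_trans _ _ ((c * t ^- 2)%:E * \int[lebesgue_Rn n]_x `|u t x|%:E)%E); last first.
  by rewrite lee_wpmul2l ?lee_fin// uL1.
rewrite -ge0_integralZl_EFin//.
apply: ae_ge0_le_integral => //.
- apply/measurable_EFinP; apply: measurableT_comp => //; exact: measurable_source_comp.
- by move=> x _; rewrite -EFinM lee_fin mulr_ge0.
- exact: measurable_funeM.
by apply: filterS (late (ltW t1)) => x hx _; rewrite lee_fin.
Qed.

Lemma source_sup_decay : exists2 B : R, 0 <= B & forall t : R, 1 <= t ->
  {ae lebesgue_Rn n, forall x,
    `|source n (u t x)| <= B * t ^- 2 * t `^ (- (n%:R / 2))}.
Proof.
pose c := Ci `^ (4 / n%:R) * expR (Ci ^+ 2).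
have c0 : 0 <= c by rewrite mulr_ge0 ?powR_ge0 ?expR_ge0.
exists (c * Ci); first by rewrite mulr_ge0.
move=> t t1; have t0 : 0 < t by exact: lt_le_trans t1.
apply: filterS2 (late t1) (usup t0) => x hs hu.
apply: le_trans hs _; rewrite -/c.
rewrite (_ : c * Ci * _ * _ = c * t ^- 2 * (Ci * t `^ (- (n%:R / 2)))); last by ring.
rewrite ler_wpM2l//.
by rewrite mulr_ge0// invr_ge0 sqr_ge0.
Qed.

Lemma integrable_source (t : R) : 0 < t ->
  (lebesgue_Rn n).-integrable setT (EFin \o (source n \o u t)).
Proof.
move=> t0; apply/integrableP; split.
  by apply/measurable_EFinP; exact: measurable_source_comp.
have [K _ hK] := source_L1_bounded.
exact: le_lt_trans (hK t t0) (ltry _).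
Qed.

(** Continuity in exp L^2 gives continuity in L^2 but not in L^1. In [source_modulus] the linear
    term is small against the uniform L^1 bound, and the quadratic term is a squared L^2
    distance. *)
Lemma cvg_source_L1 (t0 : R) : 0 < t0 ->
  (\int[lebesgue_Rn n]_x `|(source n \o u t) x - (source n \o u t0) x|%:E)%E
    @[t --> t0] --> 0%E.
Proof.
move=> t00; have t20 : 0 < t0 / 2 by rewrite divr_gt0.
have t02 : t0 / 2 <= t0 by lra.
apply: cvge0_le => ep ep0.
pose M := Ci * (t0 / 2) `^ (- (n%:R / 2)).
(* The linear term then contributes 2 e C1 <= ep / 2. *)
pose e := ep / (4 * (C1 + 1)).
have C11 : 0 < C1 + 1 by rewrite ltr_wpDl.
have e0 : 0 < e by rewrite divr_gt0// mulr_gt0.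
have [C C0 hC] := @source_modulus R n M e n1 e0.
(* The quadratic term then contributes C l^2 <= C l <= ep / 2, the first inequality by l <= 1. *)
pose l := Num.min 1 (ep / (2 * (C + 1))).
have l0 : 0 < l by rewrite lt_min ltr01 divr_gt0// mulr_gt0//; lra.
near=> t.
have tt0 : t0 / 2 < t by near: t; apply: lt_nbhsr; lra.
have tp : 0 < t by exact: lt_trans tt0.
rewrite gee0_abs ?integral_ge0//.
have mB : measurable_fun setT (u t \- u t0) by apply: measurable_funB; exact: mu_.
have hl : (expL2_norm (u t \- u t0)%R < l%:E)%E.
  by near: t; apply: cvge0_lt => //; exact: ucont.
have h2 := expL2_norm_lt_integral_sqr mB l0 hl.
have := source_L1_dist (mu_ tp) (mu_ t00) (ltW e0) C0 hC
  (sup_after t20 (ltW tt0)) (sup_after t20 t02).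
move=> /le_trans; apply.
apply: (@le_trans _ _ (e%:E * (C1%:E + C1%:E) + C%:E * (l ^+ 2)%:E)%E).
  apply: leeD; apply: lee_wpmul2l; rewrite ?lee_fin ?(ltW e0)//.
  by apply: leeD; exact: uL1.
rewrite lee_fin.
have hl1 : l <= 1 by rewrite ge_min lexx.
have hl2 : l * (2 * (C + 1)) <= ep.
  by rewrite -ler_pdivlMr ?mulr_gt0//; [rewrite ge_min lexx orbT|lra].
have he : e * (4 * (C1 + 1)) = ep by rewrite /e mulfVK// gt_eqF// mulr_gt0.
have ll : l ^+ 2 <= l by rewrite expr2 ler_piMr// ltW.
have Cl : C * l ^+ 2 <= C * l by rewrite ler_wpM2l.
nra.
Unshelve. all: by end_near.
Qed.

End along_solution.
End source_bounds.

(** * The remainder in Duhamel's formula and its integrable majorant *)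

Section duhamel_remainder.
Context {R : realType}.
Local Notation Rn n := (n.-tuple (measurableTypeR R)).
Local Notation leb := (@lebesgue_measure R).

Lemma measurable_if_itv (f : R -> R) (a b : R) :
  (forall s : R, a < s < b -> {for s, continuous f}) ->
  measurable_fun setT (fun s : measurableTypeR R => if a < s < b then f s else 0).
Proof.
move=> cf; have -> : (fun s : measurableTypeR R => if a < s < b then f s else 0) =
    f \_ `]a, b[.
  by apply/funext => s; rewrite patchE mem_setE in_itv.
apply: (measurable_restrictT _ _).1 => //.
apply: open_continuous_measurable_fun; first exact: interval_open.
by move=> s; rewrite inE /= in_itv => /cf.
Qed.

Lemma measurable_if_pos (f : R -> R) :
  (forall s : R, 0 < s -> {for s, continuous f}) ->
  measurable_fun setT (fun s : measurableTypeR R => if 0 < s then f s else 0).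
Proof.
move=> cf; have -> : (fun s : measurableTypeR R => if 0 < s then f s else 0) =
    f \_ `]0, +oo[.
  by apply/funext => s; rewrite patchE mem_setE in_itv/= andbT.
apply: (measurable_restrictT _ _).1 => //.
apply: open_continuous_measurable_fun; first exact: interval_open.
by move=> s; rewrite inE /= in_itv/= andbT => /cf.
Qed.

Lemma measurable_oneDsqrV : measurable_fun setT (fun s : measurableTypeR R => (oneDsqr s)^-1).
Proof. by apply: continuous_measurable_fun; exact: continuous_oneDsqrV. Qed.

Lemma oneDsqrV_ge0 (s : R) : 0 <= (oneDsqr s)^-1.
Proof. by rewrite invr_ge0 addr_ge0 ?sqr_ge0. Qed.

Lemma integrable_oneDsqrV (c : R) :
  leb.-integrable `]0, +oo[ (fun s => (c * (oneDsqr s)^-1)%:E).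
Proof.
have h : leb.-integrable `]0, +oo[ (fun s => ((oneDsqr s)^-1)%:E).
  apply: (@integrableS _ _ R leb `[0, +oo[%classic `]0, +oo[%classic) => //.
    by apply: subset_itvr; rewrite bnd_simp.
  apply/integrableP; split.
    apply/measurable_EFinP; apply: measurable_funTS; exact: measurable_oneDsqrV.
  under eq_integral do rewrite gee0_abs ?lee_fin ?oneDsqrV_ge0//.
  by rewrite integral0y_oneDsqr ltry.
have mI : measurable (`]0, +oo[%classic : set (measurableTypeR R)).
  exact: measurable_itv.
exact: (integrableZl mI c h).
Qed.

Variables (n : nat) (w : R -> Rn n -> R) (K B : R).
Hypothesis iw : forall s : R, 0 < s -> (lebesgue_Rn n).-integrable setT (EFin \o w s).
Hypothesis cw : forall s0 : R, 0 < s0 ->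
  (\int[lebesgue_Rn n]_x `|w s x - w s0 x|%:E)%E @[s --> s0] --> 0%E.
Hypothesis K0 : 0 <= K.
Hypothesis B0 : 0 <= B.
Hypothesis wL1 : forall s : R, 0 < s ->
  (\int[lebesgue_Rn n]_x `|w s x|%:E <= (K * (oneDsqr s)^-1)%:E)%E.
Hypothesis wsup : forall s : R, 1 <= s -> {ae lebesgue_Rn n, forall x,
  `|w s x| <= B * s ^- 2 * s `^ (- (n%:R / 2))}.

(** Set to 0 for s <= 0, where nothing is known of [w s], so that it is measurable on the whole
    line. *)
Definition mass (s : R) : R :=
  if 0 < s then fine (\int[lebesgue_Rn n]_x (w s x)%:E)%E else 0.

(** The tests on s make it vanish for s <= 0 when t > 0, so that integrals over the half-line are
    integrals over the line. *)
Definition remainder (t s : R) (x : Rn n) : R :=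
  (if 0 < s < t then fine (heat_deviation (t - s) (t + 1) (w s) x) else 0) -
  (if t <= s then mass s else 0) * heat_kernel (t + 1) x.

(* The term with L covers s > t / 2, where heat_deviation_sup is useless because
   of the singularity at s = t and the decay of the sup norm of w s is used. *)
Let L : R := K + 2 * B * 2 `^ (n%:R / 2).

Definition remainder_bound (t s : R) : R :=
  (if 0 < s < t
   then fine (weighted_defect (t - s) (t + 1) (Num.sqrt t)^-1 (w s)) else 0) +
  (if t / 2 < s then L * (oneDsqr s)^-1 else 0).

Let L0 : 0 <= L.
Proof. by rewrite addr_ge0// mulr_ge0 ?powR_ge0// mulr_ge0. Qed.

Let KL : K <= L.
Proof. by rewrite lerDl mulr_ge0 ?powR_ge0// mulr_ge0. Qed.

Let mw (s : R) : 0 < s -> measurable_fun setT (w s).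
Proof. by move=> s0; apply/measurable_EFinP; case/integrableP: (iw s0). Qed.

Lemma integral_mass (s : R) : 0 < s ->
  (\int[lebesgue_Rn n]_x (w s x)%:E = (mass s)%:E)%E.
Proof.
by move=> s0; rewrite /mass s0 fineK// integrable_fin_num//; exact: iw.
Qed.

Lemma normr_mass (s : R) : 0 < s -> `|mass s| <= K * (oneDsqr s)^-1.
Proof.
move=> s0; rewrite -lee_fin -abse_EFin -integral_mass//.
apply: le_trans (wL1 s0); apply: le_abse_integral => //.
by apply/measurable_EFinP; exact: mw.
Qed.

Lemma measurable_mass : measurable_fun setT (mass : measurableTypeR R -> R).
Proof. by apply: measurable_if_pos => s s0; exact: (continuous_mass iw cw). Qed.

Lemma integrable_mass : leb.-integrable `]0, +oo[ (fun s => (mass s)%:E).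
Proof.
have mI : measurable (`]0, +oo[%classic : set (measurableTypeR R)).
  exact: measurable_itv.
apply: (le_integrable mI _ _ (integrable_oneDsqrV K)).
- apply/measurable_EFinP; apply: measurable_funTS; exact: measurable_mass.
- move=> s; rewrite /= in_itv/= andbT => s0.
  by rewrite lee_fin (le_trans (normr_mass s0))// ler_norm.
Qed.

(** The deviation is measurable in x and, by the L^1 continuity of w, continuous in s, so
    [measurable_caratheodory] gives the joint measurability on which Tonelli's theorem rests. *)
Lemma measurable_remainder (t : R) :
  measurable_fun setT (fun p : measurableTypeR R * Rn n => remainder t p.1 p.2).
Proof.
apply: measurable_funB.
  apply: (measurable_caratheodory
    (H := fun s x => fine (heat_deviation (t - s) (t + 1) (w s) x))).
    move=> s /andP[s0 _]; apply: measurableT_comp => //.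
    by apply: measurable_heat_deviation; exact: mw.
  by move=> x s s0t; exact: (continuous_heat_deviation iw cw).
apply: measurable_funM; last first.
  exact: (measurableT_comp (@measurable_heat_kernel R n (t + 1)) measurable_snd).
have h : measurable_fun setT (fun s : measurableTypeR R => if t <= s then mass s else 0).
  apply: measurable_fun_ifT => //; last exact: measurable_mass.
  exact: measurable_fun_ler.
exact: (measurableT_comp h measurable_fst).
Qed.

Lemma measurable_remainder_bound (t : R) :
  measurable_fun setT (remainder_bound t : measurableTypeR R -> R).
Proof.
apply: measurable_funD.
  by apply: measurable_if_itv => s s0t; exact: (continuous_weighted_defect iw cw).
apply: measurable_fun_ifT => //; first exact: measurable_fun_ltr.
by apply: measurable_funM => //; exact: measurable_oneDsqrV.
Qed.

Let defect_le (t s : R) : 0 < s ->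
  (weighted_defect (t - s) (t + 1) (Num.sqrt t)^-1 (w s) <=
   (2 * K * (oneDsqr s)^-1)%:E)%E.
Proof.
move=> s0; apply: le_trans (weighted_defect_le _ _ _ (mw s0)) _.
by rewrite -mulrA EFinM lee_wpmul2l// wL1.
Qed.

Let defect_fin (t s : R) : 0 < s ->
  weighted_defect (t - s) (t + 1) (Num.sqrt t)^-1 (w s) \is a fin_num.
Proof.
move=> s0; rewrite ge0_fin_numE ?weighted_defect_ge0//.
exact: le_lt_trans (defect_le t s0) (ltry _).
Qed.

Lemma remainder_bound_ge0 (t s : R) : 0 <= remainder_bound t s.
Proof.
apply: addr_ge0; case: ifPn => // _; first by rewrite fine_ge0// weighted_defect_ge0.
by rewrite mulr_ge0// oneDsqrV_ge0.
Qed.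

(** The right-hand side does not depend on t: it is the majorant for dominated convergence as t
    tends to infinity. *)
Lemma remainder_bound_le (t s : R) : 0 < s ->
  remainder_bound t s <= (2 * K + L) * (oneDsqr s)^-1.
Proof.
move=> s0; rewrite mulrDl; apply: lerD; case: ifPn => // _.
- by rewrite -lee_fin fineK ?defect_le// defect_fin.
- by rewrite mulr_ge0 ?oneDsqrV_ge0// mulr_ge0.
- by rewrite mulr_ge0 ?oneDsqrV_ge0.
Qed.

Let tail_le (t s : R) : 0 < s -> t / 2 < s -> `|mass s| <= remainder_bound t s.
Proof.
move=> s0 ts; rewrite /remainder_bound ts.
apply: (le_trans (normr_mass s0)).
apply: (@le_trans _ _ (L * (oneDsqr s)^-1)); first by rewrite ler_wpM2r ?oneDsqrV_ge0.
by rewrite lerDr; case: ifPn => // _; rewrite fine_ge0// weighted_defect_ge0.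
Qed.

Lemma remainder_early (t s : R) (x : Rn n) : 0 < s < t ->
  (remainder t s x)%:E = heat_deviation (t - s) (t + 1) (w s) x.
Proof.
move=> s0t; have /andP[s0 st] := s0t.
rewrite /remainder s0t leNgt st/= mul0r subr0 fineK//.
by apply: heat_deviation_fin_num; [rewrite subr_gt0|exact: iw].
Qed.

Lemma remainder_late (t s : R) (x : Rn n) : t <= s ->
  remainder t s x = - (mass s * heat_kernel (t + 1) x).
Proof. by move=> ts; rewrite /remainder ts [s < t]ltNge ts andbF sub0r. Qed.

Lemma remainder_L1 (t s : R) : 0 < t -> 0 < s ->
  (\int[lebesgue_Rn n]_x `|remainder t s x|%:E <= (remainder_bound t s)%:E)%E.
Proof.
move=> t0 s0; have [st|ts] := ltP s t.
  have s0t : 0 < s < t by rewrite s0.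
  under eq_integral do rewrite -abse_EFin remainder_early//.
  apply: (le_trans (@heat_deviation_L1 R n (t - s) (t + 1) (Num.sqrt t)^-1 (w s) _ _ _ _)).
  - exact: mw.
  - by rewrite subr_gt0.
  - by rewrite lerD// lerNl (le_trans _ (ltW s0))// lerN10.
  - by rewrite invr_gt0 sqrtr_gt0.
  rewrite -(fineK (defect_fin t s0)) lee_fin /remainder_bound s0t lerDl.
  by case: ifPn => // _; rewrite mulr_ge0 ?oneDsqrV_ge0.
have t10 : 0 < t + 1 by rewrite addr_gt0.
under eq_integral do rewrite remainder_late// normrN normrM
  (ger0_norm (heat_kernel_ge0 _ _)) EFinM.
rewrite ge0_integralZl_EFin//.
- rewrite integral_heat_kernel// mule1 lee_fin tail_le//.
  by rewrite (lt_le_trans _ ts)// ltr_pdivrMr// ltr_pMr// ltr1n.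
- by move=> x _; rewrite lee_fin heat_kernel_ge0.
- by apply/measurable_EFinP; exact: measurable_heat_kernel.
Qed.

Let powRN_le (a b : R) : 0 < a -> a <= b ->
  b `^ (- (n%:R / 2)) <= a `^ (- (n%:R / 2)).
Proof.
move=> a0 ab; have b0 : 0 < b by exact: lt_le_trans ab.
rewrite !powRN lef_pV2 ?posrE ?powR_gt0//.
by apply: ge0_ler_powR; rewrite ?nnegrE ?divr_ge0// ltW.
Qed.

Let pi2 : 2 <= pi :> R. Proof. exact: pi_ge2. Qed.

(** The factor t^(-n/2) has three origins. For s >= t it comes from G(t + 1), for t/2 < s < t from
    the decay of the sup norm of [w s], and for s <= t/2 from the kernel, as 4 pi (t - s) >= t. *)
Lemma remainder_sup (t s : R) (x : Rn n) : 2 <= t -> 0 < s ->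
  `|remainder t s x| <= t `^ (- (n%:R / 2)) * remainder_bound t s.
Proof.
move=> t2 s0; have t0 : 0 < t by exact: lt_le_trans t2.
have P0 := powR_ge0 t (- (n%:R / 2)).
have t10 : 0 < t + 1 by rewrite addr_gt0.
have pt1 : (4 * pi * (t + 1)) `^ (- (n%:R / 2)) <= t `^ (- (n%:R / 2)).
  by apply: powRN_le => //; move: pi2; nra.
have [ts|st] := leP t s.
  rewrite remainder_late// normrN normrM mulrC.
  apply: ler_pM => //; last first.
    by apply: tail_le => //; rewrite (lt_le_trans _ ts)// ltr_pdivrMr// ltr_pMr// ltr1n.
  rewrite ger0_norm ?heat_kernel_ge0//.
  exact: le_trans (heat_kernel_sup _ t10) pt1.
have s0t : 0 < s < t by rewrite s0.
rewrite -lee_fin -abse_EFin remainder_early//.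
have ts0 : 0 < t - s by rewrite subr_gt0.
have [ts2|st2] := ltP (t / 2) s.
  (* Here t >= 2 is used: the sup bound on w holds from time 1 on. *)
  have s1 : 1 <= s by lra.
  pose b := B * s ^- 2 * s `^ (- (n%:R / 2)).
  have b0 : 0 <= b by rewrite mulr_ge0 ?powR_ge0// mulr_ge0// invr_ge0 sqr_ge0.
  have := @heat_deviation_le R n (t - s) (t + 1) (w s) x b ts0 t10 b0 (iw s0) (wsup s1).
  move=> /le_trans; apply.
  apply: (@le_trans _ _ (b%:E + (t `^ (- (n%:R / 2)))%:E * (K * (oneDsqr s)^-1)%:E)%E).
    by rewrite leeD2l// lee_pmul ?wL1 ?lee_fin ?powR_ge0 ?pt1//; exact: integral_ge0.
  rewrite lee_fin.
  apply: (@le_trans _ _ (t `^ (- (n%:R / 2)) * (L * (oneDsqr s)^-1))); last first.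
    rewrite ler_wpM2l// /remainder_bound ts2 lerDr.
    by case: ifPn => // _; rewrite fine_ge0// weighted_defect_ge0.
  rewrite /L mulrDl mulrDr [leLHS]addrC lerD2l /b.
  (* The constant in [L]: s^(-2) <= 2 / (1 + s^2) for s >= 1, and s^(-n/2) <= 2^(n/2) t^(-n/2) for s
     > t/2. *)
  have h1 : s ^- 2 <= 2 * (oneDsqr s)^-1.
    rewrite ler_pdivlMr; last by rewrite /oneDsqr ltr_pwDl ?sqr_ge0.
    rewrite mulrC ler_pdivrMr ?exprn_gt0// /oneDsqr mulr2n mulrDl mul1r.
    by rewrite lerD2r exprn_ege1.
  have h2 : s `^ (- (n%:R / 2)) <= t `^ (- (n%:R / 2)) * 2 `^ (n%:R / 2).
    have t20 : 0 < t / 2 by rewrite divr_gt0.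
    apply: (le_trans (powRN_le t20 (ltW ts2))).
    have e2 : 2^-1 `^ (- (n%:R / 2)) = 2 `^ (n%:R / 2) :> R.
      by rewrite -powR_inv1// -powRrM mulrNN mul1r.
    by rewrite powRM ?(ltW t0) ?invr_ge0// e2.
  rewrite (_ : _ * (2 * B * _ * _) = B * (2 * (oneDsqr s)^-1) *
    (t `^ (- (n%:R / 2)) * 2 `^ (n%:R / 2))); last by ring.
  rewrite ler_pM ?powR_ge0//; first by rewrite mulr_ge0// invr_ge0 sqr_ge0.
  by rewrite ler_wpM2l.
have := @heat_deviation_sup R n (t - s) (t + 1) (Num.sqrt t)^-1 (w s) x (mw s0) ts0.
have tt1 : t - s <= t + 1 by lra.
have sq0 : 0 < (Num.sqrt t)^-1 by rewrite invr_gt0 sqrtr_gt0.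
move=> /(_ tt1 sq0) /le_trans; apply.
rewrite -(fineK (defect_fin t s0)) -EFinM lee_fin.
apply: ler_pM; rewrite ?powR_ge0//; first by rewrite fine_ge0// weighted_defect_ge0.
  by apply: powRN_le => //; move: pi2; nra.
rewrite /remainder_bound s0t lerDl.
by case: ifPn => // _; rewrite mulr_ge0 ?oneDsqrV_ge0.
Qed.

Local Notation pos_time := (`]0%R, +oo[%classic : set (measurableTypeR R)).

Let measurable_pos_time : measurable pos_time.
Proof. exact: measurable_itv. Qed.

Lemma integral_remainder_bound_le (t : R) :
  (\int[leb]_(s in pos_time) (remainder_bound t s)%:E <=
   \int[leb]_(s in pos_time) ((2 * K + L) * (oneDsqr s)^-1)%:E)%E.
Proof.
apply: ge0_le_integral => //.
- by move=> s _; rewrite lee_fin remainder_bound_ge0.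
- by apply/measurable_EFinP; apply: measurable_funTS; exact: measurable_remainder_bound.
- apply/measurable_EFinP; apply: measurable_funTS.
  by apply: measurable_funM => //; exact: measurable_oneDsqrV.
- move=> s; rewrite /= in_itv/= andbT => s0.
  by rewrite lee_fin remainder_bound_le.
Qed.

Lemma integral_remainder_bound_fin_num (t : R) :
  (\int[leb]_(s in pos_time) (remainder_bound t s)%:E)%E \is a fin_num.
Proof.
rewrite ge0_fin_numE; last first.
  by apply: integral_ge0 => s _; rewrite lee_fin remainder_bound_ge0.
apply: le_lt_trans (integral_remainder_bound_le t) _.
have := integrable_fin_num measurable_pos_time (integrable_oneDsqrV (2 * K + L)).
by rewrite fin_numE => /andP[_]; rewrite ltey.
Qed.

(** At fixed s the first term of the bound tends to 0 by [cvg_weighted_defect0] and the second is 0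
    once t >= 2 s. *)
Lemma cvg_integral_remainder_bound (e : R) : 0 < e -> \forall t \near +oo,
  (\int[leb]_(s in pos_time) (remainder_bound t s)%:E <= e%:E)%E.
Proof.
move=> e0.
suff : fine (\int[leb]_(s in pos_time) (remainder_bound t s)%:E)%E @[t --> +oo] --> 0.
  move=> /cvgrPdist_le/(_ e e0); apply: filterS => t.
  rewrite sub0r normrN => h; rewrite -(fineK (integral_remainder_bound_fin_num t)).
  by rewrite lee_fin (le_trans _ h)// ler_norm.
apply/cvg_pinftyP => v voo; apply: fine_cvg.
suff : (\int[leb]_(s in pos_time) (remainder_bound (v j) s)%:E)%E @[j --> \oo] -->
    (\int[leb]_(s in pos_time) (cst 0%E s))%E by rewrite integral0.
apply: (@dominated_cvg _ (measurableTypeR R) R leb pos_time measurable_pos_time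
  (fun j s => (remainder_bound (v j) s)%:E) (cst 0%E)
  (fun s => ((2 * K + L) * (oneDsqr s)^-1)%:E)) => //.
- by move=> j; apply/measurable_EFinP; apply: measurable_funTS; exact: measurable_remainder_bound.
- move=> s; rewrite /= in_itv/= andbT => s0.
  apply: cvg_EFin; first by near=> j.
  rewrite -[X in _ --> X]addr0; apply: cvgD.
  + have h := cvg_weighted_defect0 (ltW s0) (iw s0) voo.
    have : fine (weighted_defect (v j - s) (v j + 1) (Num.sqrt (v j))^-1 (w s))
        @[j --> \oo] --> 0 by exact: fine_cvg.
    apply: cvg_trans; apply: near_eq_cvg; near=> j.
    rewrite s0 /= ifT//.
    by near: j; move/cvgryPgt : voo; apply.
  + have : (fun _ : nat => 0 : R) @ \oo --> 0 by exact: cvg_cst.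
    apply: cvg_trans; apply: near_eq_cvg; near=> j.
    have : s * 2 <= v j by near: j; move/cvgryPge : voo; apply.
    by rewrite -ler_pdivlMr// leNgt => /negbTE ->.
- exact: integrable_oneDsqrV.
- move=> j s; rewrite /= in_itv/= andbT => s0.
  by rewrite lee_fin ger0_norm ?remainder_bound_ge0 ?remainder_bound_le.
Unshelve. all: by end_near.
Qed.

Lemma integrable_remainder (t : R) (x : Rn n) : 2 <= t ->
  leb.-integrable pos_time (fun s => (remainder t s x)%:E).
Proof.
move=> t2.
apply: (le_integrable measurable_pos_time _ _
  (integrable_oneDsqrV (t `^ (- (n%:R / 2)) * (2 * K + L)))).
- apply/measurable_EFinP; apply: measurable_funTS.
  exact: (measurableT_comp (measurable_remainder t) (measurable_pair2 x)).
- move=> s; rewrite /= in_itv/= andbT => s0; rewrite lee_fin.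
  apply: (le_trans (remainder_sup x t2 s0)).
  rewrite (le_trans _ (ler_norm _))// -mulrA ler_wpM2l ?powR_ge0//.
  exact: remainder_bound_le.
Qed.

(** Adding the mass times G(t + 1) to the remainder gives the semigroup for s < t and 0 for s >= t.
    The mass is thus integrated over all s > 0, and the coefficient of G(t + 1) does not depend on
    t. *)
Lemma duhamel_remainder (t : R) (x : Rn n) : 2 <= t ->
  (\int[leb]_(s in `]0%R, t[) heat_semigroup (t - s) (w s) x =
   \int[leb]_(s in pos_time) (remainder t s x)%:E +
   (heat_kernel (t + 1) x)%:E * \int[leb]_(s in pos_time) (mass s)%:E)%E.
Proof.
move=> t2.
have -> : `]0%R, t[%classic = pos_time `&` `]-oo, t[%classic.
  apply/seteqP; split => s; rewrite /= !in_itv/= ?andbT.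
    by move=> /andP[].
  by move=> [-> ->].
rewrite integral_mkcondr -integralZl//; last exact: integrable_mass.
rewrite -integralD//; last 2 first.
- exact: integrable_remainder.
- exact: (integrableZl measurable_pos_time _ integrable_mass).
apply: eq_integral => s; rewrite inE /= in_itv/= andbT => s0.
rewrite patchE mem_setE in_itv/=; case: ifPn => [st|].
  have s0t : 0 < s < t by rewrite s0.
  rewrite remainder_early// -integral_mass// -heat_semigroup_deviation ?subr_gt0//.
  exact: iw.
by rewrite -leNgt => ts; rewrite remainder_late// -EFinM -EFinD mulrC addrC subrr.
Qed.

Let remainder_nonpos (t s : R) (x : Rn n) : 0 < t -> s <= 0 -> remainder t s x = 0.
Proof.
move=> t0 s0; rewrite /remainder ltNge s0 /= leNgt (le_lt_trans s0 t0) /=.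
by rewrite mul0r subr0.
Qed.

Let remainder_bound_nonpos (t s : R) : 0 < t -> s <= 0 -> remainder_bound t s = 0.
Proof.
move=> t0 s0; rewrite /remainder_bound [0 < s]ltNge s0 /= ifF ?addr0//.
by apply/negbTE; rewrite -leNgt (le_trans s0)// divr_ge0// ltW.
Qed.

(** Tonelli's theorem is applied on the whole line, and the remainder and its bound vanish for s <=
    0. *)
Let integral_pos_time (f : R -> \bar R) : (forall s : R, s <= 0 -> f s = 0%E) ->
  (\int[leb]_(s in pos_time) f s = \int[leb]_s f s)%E.
Proof.
move=> f0; rewrite integral_mkcond; apply: eq_integral => s _.
rewrite patchE mem_setE in_itv/= andbT; case: ifPn => //.
by rewrite -leNgt => /f0.
Qed.

Lemma measurable_integral_remainder (t : R) : 0 < t ->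
  measurable_fun setT
    (fun x => \int[leb]_(s in pos_time) (remainder t s x)%:E)%E.
Proof.
move=> t0.
rewrite (_ : (fun x => _) = (fun x => \int[leb]_s (remainder t s x)%:E)%E); last first.
  by apply/funext => x; apply: integral_pos_time => s s0; rewrite remainder_nonpos.
apply: (measurable_fun_integral_section leb
  (f := fun p : Rn n * measurableTypeR R => (remainder t p.2 p.1)%:E)).
apply/measurable_EFinP.
exact: (measurableT_comp (measurable_remainder t) (@measurable_swap _ _ _ _)).
Qed.

Lemma integral_remainder_L1 (t : R) : 0 < t ->
  (\int[lebesgue_Rn n]_x `|\int[leb]_(s in pos_time) (remainder t s x)%:E| <=
   \int[leb]_(s in pos_time) (remainder_bound t s)%:E)%E.
Proof.
move=> t0.
have mr := measurable_remainder t.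
have mar : measurable_fun setT (fun p : measurableTypeR R * Rn n =>
    `|remainder t p.1 p.2|%:E).
  by apply/measurable_EFinP; exact: measurableT_comp.
apply: (@le_trans _ _ (\int[lebesgue_Rn n]_x \int[leb]_s `|remainder t s x|%:E)%E).
  apply: ge0_le_integral => //.
  - by apply: measurableT_comp => //; exact: measurable_integral_remainder.
  - exact: (measurable_fun_fubini_tonelli_G (m1 := leb) (fun p : measurableTypeR R * Rn n =>
      `|remainder t p.1 p.2|%:E)).
  - move=> x _; rewrite integral_pos_time; last by move=> s s0; rewrite remainder_nonpos.
    apply: le_abse_integral => //; apply/measurable_EFinP.
    exact: (measurableT_comp mr (measurable_pair2 x)).
rewrite -(fubini_tonelli (m1 := leb) (m2 := lebesgue_Rn n)
  (fun p : measurableTypeR R * Rn n => `|remainder t p.1 p.2|%:E))//.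
rewrite integral_pos_time; last by move=> s s0; rewrite remainder_bound_nonpos.
apply: ge0_le_integral => //.
- by move=> s _; exact: integral_ge0.
- exact: (measurable_fun_fubini_tonelli_F (m2 := lebesgue_Rn n)
    (fun p : measurableTypeR R * Rn n => `|remainder t p.1 p.2|%:E)).
- by apply/measurable_EFinP; exact: measurable_remainder_bound.
move=> s _; have [s0|s0] := leP s 0; last exact: remainder_L1.
under eq_integral do rewrite remainder_nonpos// normr0.
by rewrite integral0 lee_fin remainder_bound_ge0.
Qed.

Lemma integral_remainder_sup (t : R) (x : Rn n) : 2 <= t ->
  (`|\int[leb]_(s in pos_time) (remainder t s x)%:E| <=
   (t `^ (- (n%:R / 2)))%:E *
     \int[leb]_(s in pos_time) (remainder_bound t s)%:E)%E.
Proof.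
move=> t2.
have mr : measurable_fun pos_time (fun s => (remainder t s x)%:E).
  apply/measurable_EFinP; apply: measurable_funTS.
  exact: (measurableT_comp (measurable_remainder t) (measurable_pair2 x)).
have mb : measurable_fun pos_time (fun s => (remainder_bound t s)%:E).
  by apply/measurable_EFinP; apply: measurable_funTS; exact: measurable_remainder_bound.
apply: le_trans (le_abse_integral _ measurable_pos_time mr) _.
rewrite -ge0_integralZl_EFin ?powR_ge0//; last first.
  by move=> s _; rewrite lee_fin remainder_bound_ge0.
apply: ge0_le_integral => //.
- exact: measurableT_comp.
- exact: measurable_funeM.
move=> s; rewrite /= in_itv/= andbT => s0.
by rewrite lee_fin remainder_sup.
Qed.

End duhamel_remainder.

(** * Convergence to the profile in L^1 and in the weighted sup norm *)

Section large_time_profile.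
Context {R : realType}.
Local Notation Rn n := (n.-tuple (measurableTypeR R)).
Local Notation leb := (@lebesgue_measure R).

Lemma ereal_sup_lty_bound (I : Type) (D : set I) (f : I -> \bar R) :
  (ereal_sup [set f i | i in D] < +oo)%E ->
  exists2 C : R, 0 <= C & forall i, D i -> (f i <= C%:E)%E.
Proof.
move=> h; have hub i : D i -> (f i <= ereal_sup [set f i | i in D])%E.
  by move=> Di; apply: ereal_sup_ubound; exists i.
move: h hub; case: (ereal_sup _) => [r| |]// _ hub.
- exists `|r| => // i Di; apply: le_trans (hub i Di) _.
  by rewrite lee_fin ler_norm.
- exists 0 => // i Di; exact: le_trans (hub i Di) (leNye _).
Qed.

Lemma near_weighted_defect0 n (phi : Rn n -> R) (e : R) :
  (lebesgue_Rn n).-integrable setT (EFin \o phi) -> 0 < e ->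
  \forall t \near +oo, (weighted_defect t (t + 1) (Num.sqrt t)^-1 phi <= e%:E)%E.
Proof.
move=> iphi e0.
have mphi : measurable_fun setT phi by apply/measurable_EFinP; case/integrableP: iphi.
have wfin (t : R) : weighted_defect t (t + 1) (Num.sqrt t)^-1 phi \is a fin_num.
  rewrite ge0_fin_numE ?weighted_defect_ge0//.
  apply: le_lt_trans (weighted_defect_le _ _ _ mphi) _.
  by apply: lte_mul_pinfty => //; case/integrableP: iphi.
suff : fine (weighted_defect t (t + 1) (Num.sqrt t)^-1 phi) @[t --> +oo] --> 0.
  move=> /cvgrPdist_le/(_ e e0); apply: filterS => t.
  rewrite sub0r normrN => h; rewrite -(fineK (wfin t)).
  by rewrite lee_fin (le_trans _ h)// ler_norm.
apply/cvg_pinftyP => v voo; apply: fine_cvg.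
have := cvg_weighted_defect0 (lexx 0) iphi voo.
by under eq_fun do rewrite subr0.
Qed.

(** The initial datum acts as a source at s = 0, its deviation being taken at time t itself; datum
    and remainder each receive e / 2. The two conclusions are the hypotheses of [decay_Lnorm_le]. *)
Lemma near_profile n (phi : Rn n -> R) (u w : R -> Rn n -> R) (K B e : R) :
  (lebesgue_Rn n).-integrable setT (EFin \o phi) ->
  (forall t : R, 0 < t -> measurable_fun setT (u t)) ->
  (forall s : R, 0 < s -> (lebesgue_Rn n).-integrable setT (EFin \o w s)) ->
  (forall s0 : R, 0 < s0 ->
    (\int[lebesgue_Rn n]_x `|w s x - w s0 x|%:E)%E @[s --> s0] --> 0%E) ->
  0 <= K -> 0 <= B ->
  (forall s : R, 0 < s ->
    (\int[lebesgue_Rn n]_x `|w s x|%:E <= (K * (oneDsqr s)^-1)%:E)%E) ->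
  (forall s : R, 1 <= s -> {ae lebesgue_Rn n, forall x,
    `|w s x| <= B * s ^- 2 * s `^ (- (n%:R / 2))}) ->
  (forall t : R, 0 < t -> {ae lebesgue_Rn n, forall x,
    (u t x)%:E = heat_semigroup t phi x +
      \int[leb]_(s in `]0%R, t[) heat_semigroup (t - s)%R (w s) x}%E) ->
  0 < e ->
  \forall t \near +oo,
    let m := fine (\int[lebesgue_Rn n]_x (phi x)%:E +
      \int[leb]_(s in `]0%R, +oo[) (mass w s)%:E)%E in
    (\int[lebesgue_Rn n]_x `|u t x - m * heat_kernel (t + 1) x|%:E <= e%:E)%E /\
    {ae lebesgue_Rn n, forall x,
      `|u t x - m * heat_kernel (t + 1) x| <= e * t `^ (- (n%:R / 2))}.
Proof.
move=> iphi mu_ iw cw K0 B0 wL1 wsup duh e0.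
have e20 : 0 < e / 2 by rewrite divr_gt0.
have mphi : measurable_fun setT phi by apply/measurable_EFinP; case/integrableP: iphi.
have phifin := integrable_fin_num measurableT iphi.
have massfin : (\int[leb]_(s in `]0%R, +oo[) (mass w s)%:E)%E \is a fin_num.
  apply: integrable_fin_num; first exact: measurable_itv.
  exact: (integrable_mass iw cw wL1).
near=> t; set m := fine _.
have t2 : 2 <= t by near: t; exact: nbhs_pinfty_ge.
have t0 : 0 < t by exact: lt_le_trans t2.
have hphi : (weighted_defect t (t + 1) (Num.sqrt t)^-1 phi <= (e / 2)%:E)%E.
  by near: t; exact: near_weighted_defect0.
have hrem : (\int[leb]_(s in `]0%R, +oo[) (remainder_bound w K B t s)%:E <= (e / 2)%:E)%E.
  by near: t; exact: (cvg_integral_remainder_bound iw cw K0 B0 wL1).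
pose D x := heat_deviation t (t + 1) phi x.
pose S x := (\int[leb]_(s in `]0%R, +oo[) (remainder w t s x)%:E)%E.
have sq0 : 0 < (Num.sqrt t)^-1 by rewrite invr_gt0 sqrtr_gt0.
have tt1 : t <= t + 1 by rewrite lerDl.
have gE : {ae lebesgue_Rn n, forall x,
    (u t x - m * heat_kernel (t + 1) x)%:E = (D x + S x)%E}.
  apply: filterS (duh t t0) => x ux.
  have mE : m%:E = (\int[lebesgue_Rn n]_x (phi x)%:E +
      \int[leb]_(s in `]0%R, +oo[) (mass w s)%:E)%E by rewrite fineK// fin_numD phifin.
  rewrite EFinB EFinM ux (heat_semigroup_deviation (t + 1) x t0 iphi).
  rewrite (duhamel_remainder iw cw K0 B0 wL1 wsup x t2) mE -/(D x) -/(S x).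
  have Dfin : D x \is a fin_num by exact: heat_deviation_fin_num.
  have Sfin : S x \is a fin_num.
    apply: integrable_fin_num; first exact: measurable_itv.
    exact: (integrable_remainder iw cw K0 B0 wL1 wsup).
  (* All four quantities are finite, so the identity reduces to one between real numbers. *)
  rewrite -(fineK Dfin) -(fineK Sfin) -(fineK phifin) -(fineK massfin).
  by rewrite -!(EFinM, EFinD, EFinB); congr EFin; ring.
have mD : measurable_fun setT D by exact: measurable_heat_deviation.
have mS : measurable_fun setT S by exact: (measurable_integral_remainder iw cw).
have maD : measurable_fun setT (fun x => `|D x|)%E by exact: measurableT_comp.
have maS : measurable_fun setT (fun x => `|S x|)%E by exact: measurableT_comp.
split.
- apply: (@le_trans _ _ (\int[lebesgue_Rn n]_x `|D x| + \int[lebesgue_Rn n]_x `|S x|)%E).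
    rewrite -ge0_integralD//.
    apply: ae_ge0_le_integral => //.
    + apply/measurable_EFinP; apply: measurableT_comp => //.
      apply: measurable_funB; first exact: mu_.
      by apply: measurable_funM => //; exact: measurable_heat_kernel.
    + by move=> x _; exact: adde_ge0.
    + exact: emeasurable_funD.
    + by apply: filterS gE => x gx _; rewrite -abse_EFin gx; exact: lee_abs_add.
  rewrite [e]splitr EFinD; apply: leeD.
    exact: le_trans (heat_deviation_L1 mphi t0 tt1 sq0) hphi.
  exact: le_trans (integral_remainder_L1 iw cw K0 B0 wL1 t0) hrem.
- apply: filterS gE => x gx; rewrite -lee_fin -abse_EFin gx.
  apply: le_trans (lee_abs_add _ _) _.
  rewrite mulrC [e]splitr mulrDr EFinD; apply: leeD.
    apply: le_trans (heat_deviation_sup x mphi t0 tt1 sq0) _.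
    rewrite EFinM; apply: lee_pmul => //.
    + by rewrite lee_fin powR_ge0.
    + exact: weighted_defect_ge0.
    rewrite lee_fin !powRN lef_pV2 ?posrE ?powR_gt0 ?mulr_gt0 ?pi_gt0//.
    have p4 : t <= 4 * pi * t.
      by rewrite ler_peMl ?(ltW t0)//; have := @pi_ge2 R; lra.
    by apply: ge0_ler_powR; rewrite ?nnegrE ?divr_ge0 ?(ltW t0) ?(le_trans (ltW t0) p4).
  apply: le_trans (integral_remainder_sup iw cw K0 B0 wL1 wsup x t2) _.
  by rewrite EFinM lee_wpmul2l// lee_fin powR_ge0.
Unshelve. all: by end_near.
Qed.

End large_time_profile.

(** * The asymptotic profile of the solution *)

Unset Implicit Arguments.

Theorem theorem2p4 (R : realType) (n : nat) (hn : (1 <= n)%N) :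
  exists eps : R, 0 < eps /\
  forall (phi : n.-tuple (measurableTypeR R) -> R)
         (u : R -> n.-tuple (measurableTypeR R) -> R),
    {ae lebesgue_Rn n, forall x, 0 <= phi x} ->
    expL2 phi ->
    (lebesgue_Rn n).-integrable setT (EFin \o phi) ->
    (expL2_norm phi < eps%:E)%E ->
    mild_solution phi u ->
    (ereal_sup [set expL2_norm (u t) | t in [set t : R | (0 < t)%R]]
       <= 2%:E * expL2_norm phi)%E ->
    (forall q : \bar R, (1 <= q)%E ->
      (ereal_sup [set (t `^ decay_exponent n q)%:E
                      * 'N[lebesgue_Rn n]_q[EFin \o u t]
                  | t in [set t : R | (0 < t)%R]] < +oo)%E) ->
    ((5 <= n)%N -> exists Tstar : R, 0 < Tstar /\
      (ereal_sup [set 'N[lebesgue_Rn n]_((4 / n%:R + 1)%R%:E)[EFin \o u t]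
                  | t in [set t : R | (0 < t < Tstar)%R]] < +oo)%E) ->
    exists mstar : R,
      [/\ (\int[lebesgue_Rn n]_x (u t x)%:E)%E @[t --> +oo] --> mstar%:E,
          mstar%:E = (\int[lebesgue_Rn n]_x (phi x)%:E +
            \int[@lebesgue_measure R]_(t in `]0%R, +oo[)
              \int[lebesgue_Rn n]_x (source n (u t x))%:E)%E &
          forall q : \bar R, (1 <= q)%E ->
            ((t `^ decay_exponent n q)%:E *
             'N[lebesgue_Rn n]_q[
               EFin \o (u t \- mstar \*o heat_kernel (t + 1)%R)%R])%E
              @[t --> +oo] --> 0%E].
Proof.
(* The bound by twice the norm of phi then puts the exp L^2 norm of u(t) below 1/2, the threshold of
   [expL2_norm_lt_half]. *)
exists 4^-1; split; first by rewrite invr_gt0.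
move=> phi u _ _ iphi phi_small sol sup_norm sup_Lq sup_early.
have in_pos (t : R) : 0 < t -> [set t : R | 0 < t] t by [].
have mu_ (t : R) : 0 < t -> measurable_fun setT (u t).
  by move=> t0; have [[]] := mild_expL2 sol t0.
have uexp (t : R) : 0 < t -> (expL2_norm (u t) < (2^-1)%:E)%E.
  move=> t0; apply: (@le_lt_trans _ _ (2%:E * expL2_norm phi)%E).
    by apply: le_trans sup_norm; apply: ereal_sup_ubound; exists t.
  rewrite (_ : (2^-1)%:E = 2%:E * (4^-1)%:E :> \bar R)%E; last first.
    by rewrite -EFinM; congr EFin; field.
  by rewrite lte_pmul2l.
have [C1 C10 uL1] : exists2 C1 : R, 0 <= C1 & forall t : R, 0 < t ->
    (\int[lebesgue_Rn n]_x `|u t x|%:E <= C1%:E)%E.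
  have [C C0 hC] := ereal_sup_lty_bound (sup_Lq 1%E (lexx _)).
  exists C => // t t0; have := hC t t0.
  by rewrite /decay_exponent inve1/= subrr mulr0 powRr0 mul1e Lnorm1.
have [Ci Ci0 usup] : exists2 Ci : R, 0 <= Ci & forall t : R, 0 < t ->
    {ae lebesgue_Rn n, forall x, `|u t x| <= Ci * t `^ (- (n%:R / 2))}.
  have [C C0 hC] := ereal_sup_lty_bound (sup_Lq +oo%E (leey _)).
  exists C => // t t0; apply/Lnorm_oo_le; have := hC t t0.
  rewrite /decay_exponent invey/= subr0 mulr1 => h.
  have Tn0 : 0 < t `^ (n%:R / 2) by rewrite powR_gt0.
  by rewrite powRN EFinM lee_pdivlMr// muleC.
have early : (5 <= n)%N -> exists T K : R, [/\ 0 < T, 0 <= K &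
    forall t : R, 0 < t < T ->
      (\int[lebesgue_Rn n]_x (`|u t x| `^ (4 / n%:R + 1))%:E <= K%:E)%E].
  move=> /sup_early[T [T0 hT]]; have [C C0 hC] := ereal_sup_lty_bound hT.
  have p0 : 0 < 4 / n%:R + 1 :> R by rewrite addr_gt0// divr_gt0 ?ltr0n.
  exists T, (C `^ (4 / n%:R + 1)); split => //; first exact: powR_ge0.
  move=> t tT; have := hC t tT => h.
  rewrite -poweR_EFin.
  have := powR_Lnorm (lebesgue_Rn n) (EFin \o u t) (lt0r_neq0 p0).
  rewrite (_ : (\int[_]_x _)%E = (\int[lebesgue_Rn n]_x (`|u t x| `^ (4 / n%:R + 1))%:E)%E)//.
  move=> <-; apply: (gt0_ler_poweR (ltW p0)) => //.
  - by rewrite in_itv/= leey Lnorm_ge0.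
  - by rewrite in_itv/= leey lee_fin C0.
pose w t := source n \o u t.
have ucont := mild_continuous sol.
have iw := integrable_source hn mu_ C10 Ci0 uL1 usup uexp early.
have cw := cvg_source_L1 hn mu_ C10 Ci0 uL1 usup ucont.
have [K K0 wL1] := source_L1_decay hn mu_ C10 Ci0 uL1 usup uexp early.
have [B B0 wsup] := source_sup_decay hn Ci0 usup.
pose I := (\int[lebesgue_Rn n]_x (phi x)%:E +
  \int[@lebesgue_measure R]_(s in `]0%R, +oo[) (mass w s)%:E)%E.
have Ifin : I \is a fin_num.
  rewrite fin_numD (integrable_fin_num measurableT iphi)/=.
  apply: integrable_fin_num; first exact: measurable_itv.
  exact: (integrable_mass (w := w) iw cw wL1).
pose m := fine I.
have profile (e : R) : 0 < e -> \forall t \near +oo,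
    (\int[lebesgue_Rn n]_x `|u t x - m * heat_kernel (t + 1) x|%:E <= e%:E)%E /\
    {ae lebesgue_Rn n, forall x,
      `|u t x - m * heat_kernel (t + 1) x| <= e * t `^ (- (n%:R / 2))}.
  by apply: (near_profile (w := w) iphi mu_ iw cw K0 B0 wL1 wsup); exact: mild_duhamel sol.
have iu (t : R) : 0 < t -> (lebesgue_Rn n).-integrable setT (EFin \o u t).
  move=> t0; apply/integrableP; split; first by apply/measurable_EFinP; exact: mu_.
  exact: le_lt_trans (uL1 t t0) (ltry _).
have iG (t : R) : 0 < t -> (lebesgue_Rn n).-integrable setT
    (EFin \o (fun x : n.-tuple (measurableTypeR R) => m * heat_kernel (t + 1) x)).
  move=> t0; have t10 : 0 < t + 1 by rewrite addr_gt0.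
  apply: (integrableZl measurableT m (f := EFin \o @heat_kernel R n (t + 1))).
  apply/integrableP; split; first by apply/measurable_EFinP; exact: measurable_heat_kernel.
  under eq_integral do rewrite gee0_abs ?lee_fin ?heat_kernel_ge0//.
  by rewrite integral_heat_kernel// ltry.
exists m; split.
- apply/fine_cvgP; split.
    by near=> t; apply: integrable_fin_num => //; apply: iu; near: t; exact: nbhs_pinfty_gt.
  apply/cvgrPdist_le => e e0; near=> t.
  have t0 : 0 < t by near: t; exact: nbhs_pinfty_gt.
  have [hL1 _] : (\int[lebesgue_Rn n]_x `|u t x - m * heat_kernel (t + 1) x|%:E <= e%:E)%E /\
    {ae lebesgue_Rn n, forall x,
      `|u t x - m * heat_kernel (t + 1) x| <= e * t `^ (- (n%:R / 2))}.
    by near: t; exact: profile.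
  have ufin := integrable_fin_num measurableT (iu t t0).
  rewrite /= distrC -lee_fin -abse_EFin EFinB fineK//.
  (* G(t + 1) has mass 1, so the mass of u(t) minus m is the integral of u(t) - m G(t + 1), which
     the L^1 estimate controls. *)
  have -> : (\int[lebesgue_Rn n]_x (u t x)%:E - m%:E =
      \int[lebesgue_Rn n]_x (u t x - m * heat_kernel (t + 1) x)%:E)%E.
    under [RHS]eq_integral do rewrite EFinB.
    rewrite (integralB_EFin measurableT (iu t t0) (iG t t0)); congr (_ - _)%E.
    under eq_integral do rewrite EFinM.
    rewrite integralZl//; last first.
      apply/integrableP; split; first by apply/measurable_EFinP; exact: measurable_heat_kernel.
      under eq_integral do rewrite gee0_abs ?lee_fin ?heat_kernel_ge0//.
      by rewrite integral_heat_kernel ?addr_gt0// ltry.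
    by rewrite integral_heat_kernel ?mule1// addr_gt0.
  apply: le_trans hL1; apply: le_abse_integral => //.
  apply/measurable_EFinP; apply: measurable_funB; first exact: mu_.
  by apply: measurable_funM => //; exact: measurable_heat_kernel.
- rewrite fineK//; congr (_ + _)%E; apply: eq_integral => s.
  rewrite inE /= in_itv/= andbT => s0.
  by rewrite -(integral_mass (w := w) iw s0).
- move=> q q1; apply: cvge0_le => e e0; near=> t.
  have t0 : 0 < t by near: t; exact: nbhs_pinfty_gt.
  have [hL1 hsup] : (\int[lebesgue_Rn n]_x `|u t x - m * heat_kernel (t + 1) x|%:E <= e%:E)%E /\
    {ae lebesgue_Rn n, forall x,
      `|u t x - m * heat_kernel (t + 1) x| <= e * t `^ (- (n%:R / 2))}.
    by near: t; exact: profile.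
  rewrite gee0_abs; last by rewrite mule_ge0 ?lee_fin ?powR_ge0 ?Lnorm_ge0.
  apply: decay_Lnorm_le => //.
  apply: measurable_funB; first exact: mu_.
  by apply: measurable_funM => //; exact: measurable_heat_kernel.
Unshelve. all: by end_near.
Qed.
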